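(* The space $AHHol_{\leq5}^{LF}(\mathbb{C}P^3)$ is path-connected.
   Context: Identify $S^2=\mathbb{C}P^1=\mathbb{C}\cup\{\infty\}$ with coordinate $z$, so that the antipodal map is $z\mapsto-1/\bar z$. The twistor fibration $\pi:\mathbb{C}P^3\to S^4\subset\mathbb{C}^2\oplus\mathbb{R}=\mathbb{R}^5$ is $$\pi([z_1,z_2,z_3,z_4])=\frac{\left(2(\bar z_1z_3+z_2\bar z_4),\,2(\bar z_1z_4-z_2\bar z_3),\,|z_1|^2+|z_2|^2-|z_3|^2-|z_4|^2\right)}{|z_1|^2+|z_2|^2+|z_3|^2+|z_4|^2}.$$ A holomorphic curve $\psi=[f_1,f_2,f_3,f_4]:S^2\to\mathbb{C}P^3$ is horizontal if it is tangent to the orthogonal complement (for the Fubini-Study metric) of the fibers of $\pi$; equivalently $f_1'f_2-f_1f_2'+f_3'f_4-f_3f_4'=0$. It is linearly full if its image lies in no projective hyperplane. A holomorphic curve of degree $d$ is written $[f_1,f_2,f_3,f_4]$ with $f_i$ polynomials without common zeros and maximal degree $d$, and is thereby identified with a point of $P((\mathbb{C}[z]_d)^4)$, where $\mathbb{C}[z]_d$ is the vector space of polynomials of degree at most $d$ and $P((\mathbb{C}[z]_d)^4)$ has the quotient topology. $AHHol_d^{LF}(\mathbb{C}P^3)\subset P((\mathbb{C}[z]_d)^4)$ is the subspace of linearly full horizontal holomorphic curves $\psi:S^2\to\mathbb{C}P^3$ of degree $d$ for which $\pi\circ\psi$ is invariant under the antipodal map of $S^2$. $AHHol_{\leq5}^{LF}(\mathbb{C}P^3)$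 is defined as the closure of $AHHol_5^{LF}(\mathbb{C}P^3)$ in $P((\mathbb{C}[z]_5)^4)$, with the induced topology. *)

(* Defs.v *)
From HB Require Import structures.
From mathcomp Require Import all_boot all_order all_algebra.
From mathcomp Require Import all_classical all_reals all_analysis.
From mathcomp Require Import complex generic_quotient.

Set Implicit Arguments.
Unset Strict Implicit.
Unset Printing Implicit Defensive.

Import Order.TTheory GRing.Theory Num.Theory.
Import numFieldNormedType.Exports.

Local Open Scope classical_set_scope.
Local Open Scope ring_scope.
Local Open Scope complex_scope.
Local Open Scope quotient_scope.

Section PathConnected.
Context {R : realType} {T : topologicalType}.

(* As usual for this notion, a path-connected set is required to be nonempty. *)
Definition path_connected (A : set T) : Prop :=
  A !=set0 /\
  forall x y : T, A x -> A y ->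
    exists2 f : R -> T, {within `[0, 1], continuous f} &
      [/\ f 0 = x, f 1 = y & forall t, t \in `[0, 1]%R -> A (f t)].

End PathConnected.
Arguments path_connected R {T} A.

Section RiemannSphere.
Context {R : realType}.

(* [None] is the point at infinity. *)
Definition sphere : Type := option R[i].

Definition antipode (p : sphere) : sphere :=
  match p with
  | Some z => if z == 0 then None else Some (- (z^*)^-1)
  | None => Some 0
  end.

End RiemannSphere.
Arguments sphere R : clear implicits.

Section Twistor.
Context {R : realType}.
Implicit Types v u w : 'cV[R[i]]_4.

Definition coord v (k : nat) : R[i] := v (inord k) 0.

Definition sqnormc (z : R[i]) : R := ComplexField.Normc.normc z ^+ 2.

Definition norm2 v : R := \sum_i sqnormc (v i 0).

(* The twistor fibration, on homogeneous coordinates, as a map into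
   C (+) C (+) R.  *)
Definition twistor v : R[i] * R[i] * R :=
  let z1 := coord v 0 in let z2 := coord v 1 in
  let z3 := coord v 2 in let z4 := coord v 3 in
  (2 * (z1^* * z3 + z2 * z4^*) / (norm2 v)%:C,
   2 * (z1^* * z4 - z2 * z3^*) / (norm2 v)%:C,
   (sqnormc z1 + sqnormc z2 - sqnormc z3 - sqnormc z4) / norm2 v).

Definition real_coords (x : R[i] * R[i] * R) : 'rV[R]_5 :=
  \row_(k < 5) [:: complex.Re x.1.1; complex.Im x.1.1;
                   complex.Re x.1.2; complex.Im x.1.2; x.2]`_k.

(* Tangent vectors of CP^3 at [v] are represented by vectors of C^4, modulo the
   complex line spanned by v.  The vector w represents a vector tangent to the
   fibre of the twistor fibration through [v] when the differential of the
   fibration vanishes on it. *)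
Definition vertical v w : Prop :=
  is_derive (0 : R) (1 : R)
    (fun t : R => real_coords (twistor (v + t%:C *: w))) 0.

Definition hdot v w : R[i] := \sum_i v i 0 * (w i 0)^*.

(* The Fubini-Study Riemannian metric at [v]; it is invariant under adding
   multiples of v to u and w, and is the inner product of the components of u
   and w orthogonal to v, divided by |v|^2. *)
Definition fubini_study v u w : R :=
  complex.Re ((hdot u w * hdot v v - hdot u v * hdot v w) / hdot v v ^+ 2).

End Twistor.

Section Curves.
Context {R : realType} {d : nat}.
(* Row i of a matrix A lists the d + 1 coefficients of the polynomial f_i,
   starting with the constant one. *)
Implicit Types A : 'M[R[i]]_(4, d.+1).

Definition component A (i : 'I_4) : {poly R[i]} := rVpoly (row i A).

(* The coefficients of w^d f_i(1/w). *)
Definition inverted_chart A : 'M[R[i]]_(4, d.+1) :=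
  \matrix_(i, j) A i (rev_ord j).

(* Homogeneous coordinates of the point psi(p). *)
Definition curve A (p : sphere R) : 'cV[R[i]]_4 :=
  match p with
  | Some z => \col_i (component A i).[z]
  | None => \col_i (component (inverted_chart A) i).[0]
  end.

(* A representative of the image under the differential of psi at p of the
   coordinate vector field of z (of w = 1/z if p is the point at infinity). *)
Definition velocity A (p : sphere R) : 'cV[R[i]]_4 :=
  match p with
  | Some z => \col_i ((component A i)^`()).[z]
  | None => \col_i ((component (inverted_chart A) i)^`()).[0]
  end.

Definition holomorphic_curve A : Prop :=
  (forall z : R[i], exists i, ~~ root (component A i) z) /\
  (\max_(i < 4) size (component A i))%N = d.+1.

Definition linearly_full A : Prop :=
  forall a : 'rV[R[i]]_4, a != 0 -> ~ (forall p, a *m curve A p = 0).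

(* The real tangent plane of the curve at psi(p) is spanned over R by the
   complex multiples of its velocity. *)
Definition horizontal A : Prop :=
  forall (p : sphere R) (l : R[i]) (w : 'cV[R[i]]_4),
    vertical (curve A p) w ->
    fubini_study (curve A p) (l *: velocity A p) w = 0.

Definition antipodally_invariant A : Prop :=
  forall p : sphere R, twistor (curve A (antipode p)) = twistor (curve A p).

End Curves.

Section ProjectiveSpace.
Variables (R : realType) (d : nat).

(* (C[z]_d)^4 minus the origin, with the topology induced by that of C^(4d+4).
   The type R[i]^o is R[i] with the topology of its norm. *)
Definition punctured : set 'M[R[i]^o]_(4, d.+1) := [set A | A != 0].

Definition proportional (A B : punctured) : bool :=
  `[< exists2 c : R[i]^o, c != 0 & val B = c *: val A >].

Lemma proportional_refl : reflexive proportional.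
Proof. by move=> A; apply/asboolP; exists 1; rewrite ?oner_neq0 ?scale1r. Qed.

Lemma proportional_sym : symmetric proportional.
Proof.
suff H A B : proportional A B -> proportional B A.
  by move=> A B; apply/idP/idP; exact: H.
move=> /asboolP[c c0 e]; apply/asboolP; exists c^-1; first by rewrite invr_eq0.
by rewrite e scalerA mulVf// scale1r.
Qed.

Lemma proportional_trans : transitive proportional.
Proof.
move=> B A D /asboolP[c c0 e] /asboolP[c' c'0 e']; apply/asboolP.
by exists (c' * c); rewrite ?mulf_neq0// e' e scalerA.
Qed.

Canonical proportional_equiv :=
  EquivRel proportional proportional_refl proportional_sym proportional_trans.

Definition proj_space : topologicalType :=
  quotient_topology {eq_quot proportional}.

Definition proj_point (A : punctured) : proj_space :=
  \pi_(quotient_topology {eq_quot proportional}) A.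

Definition AHHol_LF : set proj_space :=
  proj_point @` [set A : punctured |
    [/\ holomorphic_curve (val A), linearly_full (val A), horizontal (val A)
      & antipodally_invariant (val A)]].

Definition AHHol_LF_le : set proj_space := closure AHHol_LF.

End ProjectiveSpace.

Arguments proj_space R d : clear implicits.
Arguments AHHol_LF R d : clear implicits.
Arguments AHHol_LF_le R d : clear implicits.

(* Main.v *)
From mathcomp Require Import all_boot all_order all_algebra.
From mathcomp Require Import all_classical all_reals all_analysis.
From mathcomp Require Import complex generic_quotient.
From mathcomp Require Import ring lra.
Require Import Defs.

(** Let jv be the quaternionic structure of C^4 = H^2, for which v and jv v
    span the twistor fibre through v, and let sigma be the antiholomorphic involution of
    the space of curves that composes a curve with the antipodal map and with jv.

    A linearly full curve whose image in the 4-sphere is antipodally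
    invariant is a fixed point of sigma in projective space. Indeed sigma f and f
    always lie in the same twistor fibre, so that sigma f is a combination of f
    and jv f; polarizing this identity in z and its conjugate leaves no room for
    the term in jv f when f is linearly full (antipodal_cross,
    cross_proportional). Horizontality is the quadratic equation
    omega f' f = 0. Both conditions are closed (limit_curve_closed), so they hold on
    the closure of the space of curves.

    In degree 5, after multiplication by a scalar, a fixed point of sigma is
    f = a + b z + c z^2 + jv c z^3 - jv b z^4 + jv a z^5 with a, b, c in H^2, and
    horizontality becomes the five equations hor_triple on a, b, c, which are
    invariant under Sp(2). Gauss elimination by Sp(2) brings a, b, c to
    an echelon form in which the equations can be solved: what is left
    are free parameters r >= 0 and b, c in C, the pivot w of b being the positive
    root of an equation in w^2 (std_curve, std_curve_exists). Geometrically, the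
    Gram matrices of the triples form a 4-sphere, of which r = 0 is one point, and
    the curves are determined by them up to Sp(2).

    As Sp(2) is connected, every solution can be joined to the
    standard curve of parameters (1, 0, 0), by letting the parameters move on a
    segment and the matrix move to the identity (limit_path). Finally a standard curve
    with r > 0 is linearly full, and it has a common zero only if |c| = r
    (std_curve_neq0). This is avoided just after the start of the path, so that
    all the solutions are in the closure (limit_closure): the closure is the
    set of solutions of closed equations, and it is path-connected. *)

Set Implicit Arguments.
Unset Strict Implicit.
Unset Printing Implicit Defensive.

Import Order.TTheory GRing.Theory Num.Theory.
Import numFieldNormedType.Exports.

Local Open Scope classical_set_scope.
Local Open Scope complex_scope.
Local Open Scope ring_scope.

(** * The quaternionic structure of C^4 and the twistor fibration *)

Section Quaternionic.
Context {R : realType}.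
Local Notation C := R[i].
Implicit Types (u v w x y : 'cV[C]_4) (z : C).

Lemma inord4E k (h : (k < 4)%N) : inord k = Ordinal h :> 'I_4.
Proof. by apply/val_inj; rewrite /= inordK. Qed.

Lemma sum4 (V : nmodType) (F : 'I_4 -> V) :
  \sum_i F i = F (inord 0) + F (inord 1) + F (inord 2) + F (inord 3).
Proof.
rewrite !big_ord_recr big_ord0 /= add0r.
by congr (_ + _ + _ + _); congr F; apply/val_inj; rewrite /= inordK.
Qed.

Lemma forall4 (P : 'I_4 -> Prop) :
  P (inord 0) -> P (inord 1) -> P (inord 2) -> P (inord 3) -> forall i, P i.
Proof.
move=> p0 p1 p2 p3 [[|[|[|[|//]]]] h];
  by rewrite -(inord4E h).
Qed.

Definition vec4 (a b c d : C) : 'cV[C]_4 := \col_i [:: a; b; c; d]`_i.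

Lemma coord_vec4 a b c d : (coord (vec4 a b c d) 0 = a) * (coord (vec4 a b c d) 1 = b)
 * (coord (vec4 a b c d) 2 = c) * (coord (vec4 a b c d) 3 = d).
Proof. by rewrite /coord !mxE !inordK. Qed.

Lemma coordD v w k : coord (v + w) k = coord v k + coord w k.
Proof. by rewrite /coord mxE. Qed.
Lemma coordZ a v k : coord (a *: v) k = a * coord v k.
Proof. by rewrite /coord mxE. Qed.
Lemma coordN v k : coord (- v) k = - coord v k.
Proof. by rewrite /coord mxE. Qed.
Lemma coord0 k : coord (0 : 'cV[C]_4) k = 0.
Proof. by rewrite /coord mxE. Qed.

Definition coordE := (coordD, coordN, coordZ, coord_vec4, coord0).

Lemma coordP v w : coord v 0 = coord w 0 -> coord v 1 = coord w 1 ->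
  coord v 2 = coord w 2 -> coord v 3 = coord w 3 -> v = w.
Proof.
by move=> h0 h1 h2 h3; apply/matrixP => i j; rewrite ord1; move: i; apply: forall4.
Qed.

(** Multiplication by the quaternion j, for C^4 seen as H^2. It is the reason for
    the twistor fibration: the fibre through v is the projective line spanned by v
    and jv v. *)
Definition jv v := vec4 (- (coord v 1)^*) (coord v 0)^* (- (coord v 3)^*) (coord v 2)^*.

(** The complex symplectic form that expresses horizontality: a curve f is
    horizontal when omega f' f = 0. It is a Hermitian product with jv (hdot_jv). *)
Definition omega x y : C :=
  coord x 0 * coord y 1 - coord x 1 * coord y 0 +
  (coord x 2 * coord y 3 - coord x 3 * coord y 2).

Lemma hdotE x y : hdot x y = coord x 0 * (coord y 0)^* + coord x 1 * (coord y 1)^*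
  + coord x 2 * (coord y 2)^* + coord x 3 * (coord y 3)^*.
Proof. by rewrite /hdot sum4. Qed.

Lemma conj_real (x : R) : (x%:C)^* = x%:C :> C.
Proof. exact: conjc_real. Qed.

Lemma sqnormcE z : (sqnormc z)%:C = z * z^*.
Proof.
rewrite /sqnormc -[z^*]/(conjc z); case: z => a b /=.
rewrite sqr_sqrtr ?addr_ge0 ?sqr_ge0//.
by simpc; rewrite -!expr2 [a * b]mulrC addNr.
Qed.

Lemma norm2E v : (norm2 v)%:C = hdot v v.
Proof. by rewrite /norm2 rmorph_sum /=; apply: eq_bigr => i _; rewrite sqnormcE. Qed.

Lemma sqnormc_ge0 z : 0 <= sqnormc z. Proof. exact: sqr_ge0. Qed.

Lemma sqnormc_eq0 z : (sqnormc z == 0) = (z == 0).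
Proof.
by rewrite -(inj_eq (@complexI R)) sqnormcE mulf_eq0 conjC_eq0 orbb.
Qed.

Lemma norm2_eq0 v : (norm2 v == 0) = (v == 0).
Proof.
rewrite /norm2 psumr_eq0; last by move=> i _; exact: sqnormc_ge0.
apply/idP/eqP => [/allP h|->]; last first.
  by apply/allP => i _ /=; rewrite sqnormc_eq0 mxE eqxx.
apply/matrixP => i j; rewrite ord1 mxE; apply/eqP.
by have := h i (mem_index_enum _); rewrite sqnormc_eq0.
Qed.

Lemma hdot_jv x y : hdot x (jv y) = - omega x y.
Proof. rewrite hdotE /jv /omega !coordE !rmorphN /= !conjCK; ring. Qed.

(** Clifford multiplication of a spinor in C^4 by a vector N of R^5. For N on the
    unit sphere, (1 + cliff N) / 2 is the orthogonal projection onto the complex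
    plane whose projectivization is the twistor fibre over N. So the
    fibres are the fixed spaces of linear maps that depend linearly on N, which is
    easier to differentiate and to polarize than the formula for twistor. *)
Definition cliff (N : C * C * R) x : 'cV[C]_4 :=
  vec4 (N.2%:C * coord x 0 + N.1.1^* * coord x 2 + N.1.2^* * coord x 3)
       (N.2%:C * coord x 1 + N.1.1 * coord x 3 - N.1.2 * coord x 2)
       (N.1.1 * coord x 0 - N.1.2^* * coord x 1 - N.2%:C * coord x 2)
       (N.1.2 * coord x 0 + N.1.1^* * coord x 1 - N.2%:C * coord x 3).

(** The vectors v and jv v are orthogonal and have the same norm, so this is the
    formula of the projection onto their span. *)
Lemma cliff_twistor v x : v != 0 ->
  (norm2 v)%:C *: (x + cliff (twistor v) x) =
  2 *: (hdot x v *: v + hdot x (jv v) *: jv v).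
Proof.
move=> v0; have n0 : (norm2 v)%:C != 0 by rewrite (inj_eq (@complexI R)) norm2_eq0.
have E1 : (twistor v).1.1^* =
    2 * (coord v 0 * (coord v 2)^* + (coord v 1)^* * coord v 3) / (norm2 v)%:C.
  by rewrite /= rmorphM fmorphV rmorphM rmorph_nat rmorphD !rmorphM /= !conjCK conj_real.
have E2 : (twistor v).1.2^* =
    2 * (coord v 0 * (coord v 3)^* - (coord v 1)^* * coord v 2) / (norm2 v)%:C.
  by rewrite /= rmorphM fmorphV rmorphM rmorph_nat rmorphB !rmorphM /= !conjCK conj_real.
have E3 : (twistor v).2%:C = (coord v 0 * (coord v 0)^* + coord v 1 * (coord v 1)^*
   - coord v 2 * (coord v 2)^* - coord v 3 * (coord v 3)^*) / (norm2 v)%:C.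
  by rewrite -!sqnormcE -rmorphD -!rmorphB -fmorph_div.
have nE := norm2E v; rewrite hdotE in nE.
rewrite /cliff E1 E2 E3 /twistor /=.
apply: coordP; rewrite !coordE hdot_jv /omega !hdotE;
move: ((norm2 v)%:C) n0 nE => n n0 nE; field: nE => //.
Qed.

Lemma normC_neq0 v : v != 0 -> (norm2 v)%:C != 0.
Proof. by rewrite (inj_eq (@complexI R)) norm2_eq0. Qed.

Lemma hdot_jv_self v : hdot v (jv v) = 0.
Proof. by rewrite hdot_jv /omega; ring. Qed.

Lemma scale2I : injective ( *:%R 2 : 'cV[C]_4 -> _).
Proof. by apply: scalerI; rewrite pnatr_eq0. Qed.

Lemma cliff_fix v x : v != 0 -> cliff (twistor v) x = x ->
  (norm2 v)%:C *: x = hdot x v *: v + hdot x (jv v) *: jv v.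
Proof.
move=> v0 fx; have := cliff_twistor x v0; rewrite fx => e.
by apply: scale2I; rewrite -e -mulr2n scaler_nat -scalerMnr.
Qed.

Lemma cliff_self v : v != 0 -> cliff (twistor v) v = v.
Proof.
move=> v0; have := cliff_twistor v v0; rewrite hdot_jv_self scale0r addr0 norm2E.
rewrite scalerA mulrC -scalerA.
have n0 := normC_neq0 v0; rewrite norm2E in n0.
by move=> /(scalerI n0); rewrite scaler_nat mulr2n => /addrI.
Qed.

Lemma norm2_comb a b v :
  norm2 (a *: v + b *: jv v) = (sqnormc a + sqnormc b) * norm2 v.
Proof.
apply: complexI; rewrite norm2E rmorphM rmorphD /= !sqnormcE norm2E !hdotE.
rewrite /jv !coordE !(rmorphD, rmorphM, rmorphN) /= !conjCK; ring.
Qed.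

Lemma twistor_comb a b v : (a != 0) || (b != 0) -> v != 0 ->
  twistor (a *: v + b *: jv v) = twistor v.
Proof.
move=> ab v0.
have m0 : (sqnormc a)%:C + (sqnormc b)%:C != 0.
  rewrite -rmorphD (inj_eq (@complexI R)) paddr_eq0 ?sqnormc_ge0//.
  by rewrite !sqnormc_eq0 negb_and.
have n0 := normC_neq0 v0.
have E3 w : (twistor w).2%:C = (coord w 0 * (coord w 0)^* + coord w 1 * (coord w 1)^*
   - coord w 2 * (coord w 2)^* - coord w 3 * (coord w 3)^*) / (norm2 w)%:C.
  by rewrite -!sqnormcE -rmorphD -!rmorphB -fmorph_div.
have nE : (norm2 (a *: v + b *: jv v))%:C = ((sqnormc a)%:C + (sqnormc b)%:C) * (norm2 v)%:C.
  by rewrite norm2_comb rmorphM rmorphD.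
rewrite [LHS]surjective_pairing [RHS]surjective_pairing.
congr (_, _); last first.
  apply: complexI; rewrite !E3 nE.
  move: n0 m0; rewrite !sqnormcE /jv !coordE !(rmorphD, rmorphM, rmorphN) /= !conjCK.
  move: ((norm2 v)%:C) => n n0 m0; field; exact/andP.
rewrite /twistor /= nE.
congr (_, _); move: n0 m0; rewrite !sqnormcE /jv !coordE !(rmorphD, rmorphM, rmorphN) /= !conjCK;
  move: ((norm2 v)%:C) => n n0 m0; field; exact/andP.
Qed.

Lemma vertical_jv v : v != 0 -> vertical v (jv v).
Proof.
move=> v0; rewrite /vertical.
have -> : (fun t : R => real_coords (twistor (v + t%:C *: jv v))) =
          cst (real_coords (twistor v)).
  apply/funext => t; rewrite -{1}[v]scale1r twistor_comb ?oner_eq0//.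
exact: is_derive_cst.
Qed.

End Quaternionic.

(** * Vertical vectors *)

Section Vertical.
Context {R : realType}.
Local Notation C := R[i].
Implicit Types (u v w x y : 'cV[C]_4) (z : C).

Lemma cliffD (N : C * C * R) x y : cliff N (x + y) = cliff N x + cliff N y.
Proof. by apply: coordP; rewrite /cliff !coordE; ring. Qed.

Lemma cliffZ (N : C * C * R) c x : cliff N (c *: x) = c *: cliff N x.
Proof. by apply: coordP; rewrite /cliff !coordE; ring. Qed.

(** The Clifford generators: the coordinate vectors of R^5 = C + C + R. *)
Definition cliff_gen (k : 'I_5) : C * C * R :=
  nth (0, 0, 0) [:: (1, 0, 0); ('i%C, 0, 0); (0, 1, 0); (0, 'i%C, 0); (0, 0, 1)] k.

Lemma cliff_real_coords N x :
  cliff N x = \sum_k (real_coords N 0 k)%:C *: cliff (cliff_gen k) x.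
Proof.
rewrite !big_ord_recr big_ord0 /= add0r /real_coords !mxE /cliff_gen /=.
case: N => -[[a b] [c d]] e /=.
have iC : ('i : C)^* = - 'i by rewrite -[LHS]/(conjc _) /=; simpc.
have E (p q : R) : (p +i* q) = p%:C + 'i * q%:C :> C by rewrite [LHS]complexE.
have EC (p q : R) : (p +i* q)^* = p%:C - 'i * q%:C :> C.
  by rewrite E rmorphD rmorphM /= !conj_real iC mulNr.
have c1 : (1 : C)^* = 1 by rewrite rmorph1.
have c0 : (0 : C)^* = 0 by rewrite rmorph0.
by apply: coordP; rewrite /cliff !coordE /= ?EC ?E ?iC ?c1 ?c0 ?rmorph0 ?rmorph1; ring.
Qed.

Lemma is_derive_coords (phi : R -> 'rV[R]_5) (c : 'I_5 -> R) :
  is_derive (0 : R) (1 : R) phi 0 ->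
  is_derive (0 : R) (1 : R) (fun t => \sum_k phi t 0 k * c k) 0.
Proof.
move=> [dphi phi0].
have dk k : is_derive (0 : R) (1 : R) (fun t => phi t 0 k) 0.
  have /derivable_mxP/(_ 0 k) d := dphi.
  apply: DeriveDef => //; move: phi0; rewrite derive_mx// => /matrixP/(_ 0 k).
  by rewrite !mxE.
have -> : (fun t => \sum_k phi t 0 k * c k) = \sum_k (c k \*: (fun t => phi t 0 k)).
  apply/funext => t; rewrite fct_sumE; apply: eq_bigr => k _.
  by rewrite /= mulrC.
by apply: is_derive_eq; rewrite big1// => k _; rewrite scaler0.
Qed.

(** The vector v + t w is fixed by Clifford multiplication by its own image under
    twistor. That image has derivative 0 at t = 0, so differentiating this identity
    leaves only the term in which the factor v + t w is differentiated. *)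
Lemma vertical_cliff v w : v != 0 -> vertical v w -> cliff (twistor v) w = w.
Proof.
move=> v0 vw.
(* If the line t |-> v + t w meets 0, then w is a real multiple of v. *)
have [[t t0]|ne] := pselect (exists t : R, v + t%:C *: w = 0).
  have tn0 : t%:C != 0 :> C.
    by apply: contra_neq v0 => e; move: t0; rewrite e scale0r addr0.
  have -> : w = - (t%:C)^-1 *: v.
    move/eqP: t0; rewrite addr_eq0 => /eqP ->.
    by rewrite scalerN scaleNr opprK scalerA mulVf// scale1r.
  by rewrite cliffZ cliff_self.
have {}ne t : v + t%:C *: w != 0 by apply/eqP => e; apply: ne; exists t.
pose phi t := real_coords (twistor (v + t%:C *: w)).
(* F is the real or the imaginary part. *)
have key (F : C -> R) i : (forall a b, F (a + b) = F a + F b) ->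
    (forall (t : R) a, F (t%:C * a) = t * F a) ->
    F (cliff (twistor v) w i 0) = F (w i 0).
  move=> FD FZ.
  have F0 : F 0 = 0 by rewrite -[0 in LHS](mul0r (0 : C)) -[0 in LHS](rmorph0 (real_complex R)) FZ mul0r.
  have FS (a : 'I_5 -> C) : F (\sum_k a k) = \sum_k F (a k).
    exact: (big_morph F FD F0).
  have entryD (a b : 'cV[C]_4) : (a + b) i 0 = a i 0 + b i 0 by rewrite mxE.
  have entryZ (t : C) (a : 'cV[C]_4) : (t *: a) i 0 = t * a i 0 by rewrite mxE.
  pose c x k := F (cliff (cliff_gen k) x i 0).
  have FE t x : F (cliff (twistor (v + t%:C *: w)) x i 0) = \sum_k phi t 0 k * c x k.
    rewrite cliff_real_coords summxE FS; apply: eq_bigr => k _.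
    by rewrite mxE FZ.
  have E t : \sum_k phi t 0 k * c v k + t * \sum_k phi t 0 k * c w k =
      F (v i 0) + t * F (w i 0).
    have := cliff_self (ne t); rewrite cliffD cliffZ => /matrixP/(_ i 0).
    by rewrite !entryD !entryZ => /(congr1 F); rewrite !FD !FZ !FE.
  have dv := is_derive_coords (c v) vw.
  have dw := is_derive_coords (c w) vw.
  have dE : is_derive (0 : R) (1 : R) (fun t => \sum_k phi t 0 k * c v k +
      t * \sum_k phi t 0 k * c w k) (\sum_k phi 0 0 k * c w k).
    have -> : (fun t => \sum_k phi t 0 k * c v k + t * \sum_k phi t 0 k * c w k) =
      (fun t => \sum_k phi t 0 k * c v k) + id * (fun t => \sum_k phi t 0 k * c w k) by [].
    by apply: is_derive_eq; rewrite scaler0 add0r add0r [LHS]mulr1.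
  have dE' : is_derive (0 : R) (1 : R) (fun t => F (v i 0) + t * F (w i 0)) (F (w i 0)).
    have -> : (fun t => F (v i 0) + t * F (w i 0)) =
      cst (F (v i 0)) + (F (w i 0) \*: id).
      by apply/funext => t; rewrite /= [RHS]addrC addrC; congr (_ + _); rewrite mulrC.
    by apply: is_derive_eq; rewrite add0r [LHS]mulr1.
  have : \sum_k phi 0 0 k * c w k = F (w i 0).
    have [_ <-] := dE; have [_ <-] := dE'.
    by under eq_fun => t do rewrite E.
  by rewrite -FE scale0r addr0.
apply/matrixP => i j; rewrite ord1; apply/eqP; rewrite eq_complex.
apply/andP; split; apply/eqP; apply: (key (fun z => complex.Re z)) || apply: (key (fun z => complex.Im z)).
1,3: by move=> [? ?] [? ?].
1,2: by move=> t [? ?] /=; rewrite mul0r ?subr0 ?addr0.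
Qed.

(** A vertical w is a combination of v and jv v (vertical_cliff, cliff_fix). The
    metric ignores the component along v, and omega u v = 0 says that u is
    orthogonal to jv v. *)
Lemma fubini_study_vertical u v w : v != 0 -> omega u v = 0 -> vertical v w ->
  fubini_study v u w = 0.
Proof.
move=> v0 uv /(vertical_cliff v0)/(cliff_fix v0) nw.
have hZ a x y : hdot x (a *: y) = a^* * hdot x y.
  by rewrite !hdotE !coordE !rmorphM; ring.
have hD x y y' : hdot x (y + y') = hdot x y + hdot x y'.
  by rewrite !hdotE !coordE !rmorphD; ring.
have := congr1 (hdot u) nw; rewrite hD !hZ [hdot u (jv v)]hdot_jv uv oppr0 mulr0 addr0.
rewrite conj_real norm2E.
have -> : (hdot w v)^* = hdot v w.
  by rewrite !hdotE !(rmorphD, rmorphM) /= !conjCK; ring.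
move=> e; rewrite /fubini_study [hdot u w * _]mulrC e [hdot v w * _]mulrC subrr mul0r.
by [].
Qed.

Lemma omegaZl a x y : omega (a *: x) y = a * omega x y.
Proof. by rewrite /omega !coordE; ring. Qed.

End Vertical.

(** * Curves and the antipodal map *)

Section Curve.
Context {R : realType} {d : nat}.
Local Notation C := R[i].
Implicit Types (A : 'M[C]_(4, d.+1)) (v w : 'cV[C]_4).

Lemma jvD v w : jv (v + w) = jv v + jv w.
Proof. by apply: coordP; rewrite /jv !coordE !rmorphD /= ?opprD. Qed.

Lemma jvZ a v : jv (a *: v) = a^* *: jv v.
Proof. by apply: coordP; rewrite /jv !coordE !rmorphM /=; ring. Qed.

Lemma jv0 : jv (0 : 'cV[C]_4) = 0.
Proof. by have := jvZ 0 (0 : 'cV[C]_4); rewrite conjC0 !scale0r. Qed.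

Lemma jv_sum (I : finType) (f : I -> 'cV[C]_4) : jv (\sum_i f i) = \sum_i jv (f i).
Proof. exact: (big_morph jv jvD jv0). Qed.

Lemma jvK v : jv (jv v) = - v.
Proof. by apply: coordP; rewrite /jv !coordE ?rmorphN /= ?conjCK; ring. Qed.

Lemma jv_eq0 v : (jv v == 0) = (v == 0).
Proof.
apply/eqP/eqP => [e|->]; last exact: jv0.
by apply: oppr_inj; rewrite -jvK e jv0 oppr0.
Qed.

Lemma componentE A i : component A i = \sum_(k < d.+1) A i k *: 'X^k.
Proof.
rewrite /component /rVpoly poly_def; apply: eq_bigr => k _.
by rewrite insubT ?ltn_ord//= => h; rewrite mxE; congr (A _ _ *: _); apply/val_inj.
Qed.

Lemma coef_component A i (k : 'I_d.+1) : (component A i)`_k = A i k.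
Proof. by rewrite /component coef_rVpoly_ord mxE. Qed.

Lemma curveE A z : curve A (Some z) = \sum_(k < d.+1) z ^+ k *: col k A.
Proof.
apply/matrixP => i j; rewrite ord1 summxE mxE componentE horner_sum.
by apply: eq_bigr => k _; rewrite !mxE hornerZ hornerXn mulrC.
Qed.

Lemma curve_inf A : curve A None = col ord_max A.
Proof.
apply/matrixP => i j; rewrite ord1 mxE horner_coef0.
have -> := coef_component (inverted_chart A) i ord0.
by rewrite !mxE; congr (A _ _); apply/val_inj; rewrite /= subn1.
Qed.

Lemma curve0 A : curve A (Some 0) = col ord0 A.
Proof.
apply/matrixP => i j; rewrite ord1 mxE horner_coef0.
by have -> := coef_component A i ord0; rewrite mxE.
Qed.

Lemma velocityE A z : velocity A (Some z) = \sum_(k < d.+1) (z ^+ k.-1 *+ k) *: col k A.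
Proof.
apply/matrixP => i j; rewrite ord1 summxE mxE componentE raddf_sum horner_sum.
by apply: eq_bigr => k _; rewrite !mxE /= derivZ derivXn hornerZ hornerMn hornerXn mulrC.
Qed.

(** The action on coefficients of the antiholomorphic involution that composes a
    curve with the antipodal map and with jv; see curve_sigma. *)
Definition sigma A : 'M[C]_(4, d.+1) :=
  \matrix_(i, k) ((-1) ^+ rev_ord k * jv (col (rev_ord k) A) i 0).

Lemma col_sigma A k : col k (sigma A) = (-1) ^+ rev_ord k *: jv (col (rev_ord k) A).
Proof. by apply/matrixP => i j; rewrite !ord1 !mxE. Qed.

Lemma curve_sigma A z : z != 0 ->
  curve (sigma A) (Some z) = z ^+ d *: jv (curve A (antipode (Some z))).
Proof.
move=> z0; rewrite [antipode _]/= (negbTE z0) !curveE jv_sum scaler_sumr.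
rewrite (reindex_inj rev_ord_inj) /=. apply: eq_bigr => k _.
rewrite col_sigma rev_ordK jvZ !scalerA; congr (_ *: _).
have -> : ((- (z^*)^-1) ^+ k)^* = (-1) ^+ k / z ^+ k.
  by rewrite rmorphXn /= rmorphN /= fmorphV /= conjCK [LHS]exprNn exprVn.
have kd : (k <= d)%N by rewrite -ltnS.
have -> : z ^+ d = z ^+ (d - k) * z ^+ k by rewrite -exprD subnK.
by rewrite /= subSS mulrCA mulfK ?expf_neq0// mulrC.
Qed.

Lemma curve_sigma0 A : curve (sigma A) (Some 0) = (-1) ^+ d *: jv (curve A None).
Proof.
have e : rev_ord ord0 = ord_max :> 'I_d.+1 by apply/val_inj; rewrite /= subn1.
by rewrite curve0 curve_inf col_sigma e.
Qed.

Lemma curve_sigma_inf A : curve (sigma A) None = jv (curve A (Some 0)).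
Proof.
have e : rev_ord ord_max = ord0 :> 'I_d.+1 by apply/val_inj; rewrite /= subnn.
by rewrite curve0 curve_inf col_sigma e expr0 scale1r.
Qed.

Lemma twistor_jv v : v != 0 -> twistor (jv v) = twistor v.
Proof.
by move=> v0; rewrite -[jv v]add0r -(scale0r v) -[X in _ + X]scale1r twistor_comb ?oner_eq0 ?orbT.
Qed.

Lemma twistorZ a v : a != 0 -> v != 0 -> twistor (a *: v) = twistor v.
Proof.
by move=> a0 v0; rewrite -[a *: v]addr0 -(scale0r (jv v)) twistor_comb ?a0.
Qed.

Lemma sigma_antipodal A : sigma A = A -> (forall p, curve A p != 0) ->
  antipodally_invariant A.
Proof.
move=> sA A0 [z|]; last first.
  by rewrite -[in RHS]sA curve_sigma_inf twistor_jv.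
have [->|z0] := eqVneq z 0.
  rewrite [antipode _]/= eqxx -[in RHS]sA curve_sigma0.
  by rewrite twistorZ ?twistor_jv ?jv_eq0// signr_eq0.
rewrite -[in RHS]sA curve_sigma// twistorZ ?twistor_jv ?jv_eq0//.
by rewrite expf_neq0.
Qed.

Lemma sigmaE A i k : sigma A i k = (-1) ^+ rev_ord k * jv (col (rev_ord k) A) i 0.
Proof. by rewrite mxE. Qed.

Lemma omega_horizontal A : (forall p, curve A p != 0) ->
  (forall p, omega (velocity A p) (curve A p) = 0) -> horizontal A.
Proof.
move=> A0 hA p l w; apply: fubini_study_vertical => //.
by rewrite omegaZl hA mulr0.
Qed.

(** Test the metric on the vertical vector jv v: the multiples of the
    velocity by complex numbers get rid of the real part in fubini_study. *)
Lemma horizontal_omega A p : horizontal A -> curve A p != 0 ->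
  omega (velocity A p) (curve A p) = 0.
Proof.
move=> hA v0; set u := velocity A p; set v := curve A p in v0 *.
apply/eqP; rewrite -sqnormc_eq0; apply/eqP/(@complexI R).
have := hA p (- (omega u v)^*) _ (vertical_jv v0).
rewrite -/u -/v /fubini_study hdot_jv_self mulr0 subr0 hdot_jv omegaZl -norm2E.
have -> : - (- (omega u v)^* * omega u v) * (norm2 v)%:C / (norm2 v)%:C ^+ 2 =
    (sqnormc (omega u v) / norm2 v)%:C.
  by rewrite fmorph_div /= sqnormcE; have := normC_neq0 v0; move: ((norm2 v)%:C) => n n0; field.
move=> /= /eqP; rewrite mulf_eq0 invr_eq0 norm2_eq0 (negbTE v0) orbF => /eqP.
by move=> ->.
Qed.

Lemma holomorphic_neq0 A p : holomorphic_curve A -> curve A p != 0.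
Proof.
case=> nz sz; case: p => [z|].
  have [k] := nz z; apply: contraNneq => /matrixP/(_ k 0).
  by rewrite !mxE => e; apply/rootP.
apply/eqP; rewrite curve_inf => e.
suff : (\max_(i < 4) size (component A i) <= d)%N by rewrite sz ltnn.
apply/bigmax_leqP => i _; apply/leq_sizeP => j dj.
have := dj; rewrite leq_eqVlt => /orP[/eqP <-|dj'].
  have := coef_component A i ord_max => /= ->.
  by move/matrixP: e => /(_ i 0); rewrite !mxE.
by rewrite nth_default// (leq_trans _ dj')// size_poly.
Qed.

End Curve.

(** * Polarization *)

Section Polarization.
Context {R : realType}.
Local Notation C := R[i].

Lemma poly_eq0_nat (p : {poly C}) : (forall n : nat, p.[n.+1%:R] = 0) -> p = 0.
Proof.
move=> h; apply/eqP; apply: contraT => p0.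
have := @max_poly_roots _ p [seq n.+1%:R | n <- iota 0 (size p)] p0.
rewrite size_map size_iota ltnn; apply.
  by apply/allP => z /mapP[n _ ->]; apply/rootP.
by rewrite map_inj_uniq ?iota_uniq// => m n /eqP; rewrite eqr_nat eqSS => /eqP.
Qed.

Lemma poly_eq0 (p : {poly C}) : (forall z, p.[z] = 0) -> p = 0.
Proof. by move=> h; apply: poly_eq0_nat. Qed.

(** In terms of z = x + i y the sum is a polynomial in x and y. It vanishes
    for real x and y, hence, in one variable after the other, for complex x and y;
    then x + i y and x - i y take arbitrary independent values. *)
Lemma polarization (I : finType) (p q : I -> {poly C}) :
  (forall z, z != 0 -> \sum_i (p i).[z] * (q i).[z^*] = 0) ->
  forall z w, \sum_i (p i).[z] * (q i).[w] = 0.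
Proof.
move=> h.
have iC : ('i%C : C)^* = - 'i%C by rewrite -[LHS]/(conjc _) /=; simpc.
have step1 (y : R) x :
    \sum_i (p i).[x + 'i%C * y%:C] * (q i).[x - 'i%C * y%:C] = 0.
  pose P := \sum_i (p i \Po ('X + ('i%C * y%:C)%:P)) * (q i \Po ('X - ('i%C * y%:C)%:P)).
  have PE t : P.[t] = \sum_i (p i).[t + 'i%C * y%:C] * (q i).[t - 'i%C * y%:C].
    by rewrite horner_sum; apply: eq_bigr => i _; rewrite hornerM !horner_comp !hornerE.
  rewrite -PE (_ : P = 0) ?horner0//; apply: poly_eq0_nat => n.
  rewrite PE -[RHS](h (n.+1%:R + 'i%C * y%:C)).
    by rewrite rmorphD rmorphM rmorph_nat /= iC conj_real mulNr.
  apply/eqP => /(congr1 (@complex.Re R)).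
  have -> : n.+1%:R = (n.+1%:R)%:C :> C by rewrite rmorph_nat.
  by rewrite /=; simpc => /eqP; rewrite pnatr_eq0.
have step2 x y : \sum_i (p i).[x + 'i%C * y] * (q i).[x - 'i%C * y] = 0.
  pose P := \sum_i (p i \Po (x%:P + 'i%C *: 'X)) * (q i \Po (x%:P - 'i%C *: 'X)).
  have PE t : P.[t] = \sum_i (p i).[x + 'i%C * t] * (q i).[x - 'i%C * t].
    by rewrite horner_sum; apply: eq_bigr => i _; rewrite hornerM !horner_comp !hornerE.
  rewrite -PE (_ : P = 0) ?horner0//; apply: poly_eq0_nat => n.
  rewrite PE -[RHS](step1 n.+1%:R x).
  by have -> : n.+1%:R = (n.+1%:R)%:C :> C by rewrite rmorph_nat.
move=> z w; rewrite -[RHS](step2 ((z + w) / 2) ('i%C * (w - z) / 2)).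
have ii : 'i%C * 'i%C = -1 :> C by rewrite -expr2 sqr_i.
apply: eq_bigr => i _; congr (_.[_] * _.[_]); by field: ii.
Qed.

End Polarization.

(** * Antipodally invariant curves *)

Section Invariant.
Context {R : realType} {d : nat}.
Local Notation C := R[i].
Implicit Types (A B : 'M[C]_(4, d.+1)).

Lemma linearly_full_coef A (a : 'I_4 -> C) : linearly_full A ->
  (forall z, \sum_i a i * (component A i).[z] = 0) -> forall i, a i = 0.
Proof.
move=> lf h i; apply/eqP; apply: contraT => ai.
have /lf[] : (\row_i a i) != 0.
  by apply: contra ai => /eqP/matrixP/(_ 0 i); rewrite !mxE => ->.
have h0 : \sum_i a i *: component A i = 0.
  by apply: poly_eq0 => z; rewrite horner_sum -[RHS](h z); apply: eq_bigr => k _; rewrite hornerZ.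
move=> p; apply/matrixP => r s; rewrite !ord1 !mxE.
case: p => [z|].
  by rewrite -[RHS](h z); apply: eq_bigr => k _; rewrite !mxE.
have /polyP/(_ d) := h0; rewrite coef_sum coef0 => e; rewrite -[RHS]e.
apply: eq_bigr => k _; rewrite curve_inf !mxE coefZ.
by have /= -> := coef_component A k ord_max.
Qed.

Definition cross (x y : 'cV[C]_4) i j := x i 0 * y j 0 - y i 0 * x j 0.

(** At the antipode the curve has a value v' with the same image under twistor as
    v, and g is a multiple of jv v'. Hence Clifford multiplication by twistor v
    fixes g. *)
Lemma antipodal_cliff A z : holomorphic_curve A -> antipodally_invariant A ->
  z != 0 -> let v := curve A (Some z) in let g := curve (sigma A) (Some z) in
  hdot v v *: g = hdot g v *: v - omega g v *: jv v.
Proof.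
move=> hA aA z0 v g; have v0 : v != 0 by exact: holomorphic_neq0.
rewrite -norm2E -scaleNr -hdot_jv; apply: cliff_fix => //.
rewrite /g curve_sigma// cliffZ /v -aA; congr (_ *: _).
by rewrite -twistor_jv ?cliff_self ?jv_eq0// holomorphic_neq0.
Qed.

(** Write v for the curve and g for its image under sigma. The equations of
    antipodal_cliff are linear in the conjugates of the coordinates of v.
    Polarization frees these conjugates from z, and then linear fullness makes
    each of their coefficients vanish. The resulting equations say that the minors
    of v and g are the entries of a fixed antisymmetric matrix times omega g v.
    The minors (0, 1) and (2, 3) add up to - omega g v by definition and to
    - 2 omega g v by these equations; so omega g v vanishes, and with it all the
    minors. *)
Lemma antipodal_cross A z : holomorphic_curve A -> linearly_full A ->
  antipodally_invariant A -> forall i j,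
  cross (curve A (Some z)) (curve (sigma A) (Some z)) i j = 0.
Proof.
move=> hA lA aA.
pose f i : {poly C} := component A i; pose g i : {poly C} := component (sigma A) i.
pose om : {poly C} := g (inord 0) * f (inord 1) - g (inord 1) * f (inord 0) +
  (g (inord 2) * f (inord 3) - g (inord 3) * f (inord 2)).
pose e (k : 'I_4) : 'cV[C]_4 := \col_i (i == k)%:R.
(* P i k is the coefficient, in the equation k of antipodal_cliff, of the
   conjugate of the coordinate i of the curve. *)
pose P i k := f i * g k - g i * f k + jv (e i) k 0 *: om.
have fE i z' : (curve A (Some z')) i 0 = (f i).[z'] by rewrite mxE.
have gE i z' : (curve (sigma A) (Some z')) i 0 = (g i).[z'] by rewrite mxE.
have fC i z' : (map_poly Num.conj (f i)).[z'^*] = ((f i).[z'])^* by rewrite horner_map.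
have jE (w : 'cV[C]_4) k : (jv w) k 0 = \sum_i (w i 0)^* * jv (e i) k 0.
  have {1}-> : w = \sum_i w i 0 *: e i.
    apply/matrixP => r s; rewrite ord1 summxE (bigD1 r)//= !mxE eqxx mulr1.
    by rewrite big1 ?addr0// => i ir; rewrite !mxE eq_sym (negbTE ir) mulr0.
  by rewrite jv_sum summxE; apply: eq_bigr => i _; rewrite jvZ mxE.
have omE z' : om.[z'] = omega (curve (sigma A) (Some z')) (curve A (Some z')).
  by rewrite /omega /coord !fE !gE !(hornerD, hornerM, hornerN).
have PE i k z' : (P i k).[z'] = cross (curve A (Some z')) (curve (sigma A) (Some z')) i k
    + jv (e i) k 0 * omega (curve (sigma A) (Some z')) (curve A (Some z')).
  by rewrite /cross !fE !gE -omE !(hornerD, hornerM, hornerN, hornerZ).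
have Ppol k z' : z' != 0 -> \sum_i (P i k).[z'] * (map_poly Num.conj (f i)).[z'^*] = 0.
  move=> z0; have := antipodal_cliff hA aA z0.
  set v := curve A _; set w := curve (sigma A) _ => /= /matrixP/(_ k 0).
  have eM (a : C) (u : 'cV[C]_4) : (a *: u) k 0 = a * u k 0 by rewrite mxE.
  have eB (u u' : 'cV[C]_4) : (u - u') k 0 = u k 0 - u' k 0 by rewrite !mxE.
  rewrite eB !eM jE /hdot !mulr_suml mulr_sumr => /eqP.
  rewrite -subr_eq0 => /eqP E; rewrite -[RHS]E.
  rewrite -!sumrB; apply: eq_bigr => i _; rewrite PE fC -fE -/v -/w /cross; ring.
have P0 i k z' : (P i k).[z'] = 0.
  suff : ((P i k).[z'])^* = 0 by move/eqP; rewrite conjC_eq0 => /eqP.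
  move: i.
  apply: (@linearly_full_coef A (fun i => ((P i k).[z'])^*)) => // w.
  have := polarization (Ppol k) z' (w^*) => /(congr1 Num.conj).
  rewrite conjC0 rmorph_sum /= => E; rewrite -[RHS]E; apply: eq_bigr => i _.
  by rewrite rmorphM /= fC conjCK.
have om0 : omega (curve (sigma A) (Some z)) (curve A (Some z)) = 0.
  have j01 : jv (e (inord 0)) (inord 1) 0 = 1.
    by rewrite -/(coord _ 1) /jv coord_vec4 /coord mxE eqxx conjC1.
  have j23 : jv (e (inord 2)) (inord 3) 0 = 1.
    by rewrite -/(coord _ 3) /jv coord_vec4 /coord mxE eqxx conjC1.
  have := P0 (inord 0) (inord 1) z; have := P0 (inord 2) (inord 3) z.
  rewrite !PE j01 j23 !mul1r /cross /omega /coord => E1 E2.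
  by have := congr2 +%R E2 E1; rewrite addr0 => <-; ring.
by move=> i j; have := P0 i j z; rewrite PE om0 mulr0 addr0.
Qed.

(** Some component f0 of A has degree d. The components of A have no common
    root, so f0 divides the corresponding component g0 of B, and the quotient is
    constant because the degree of g0 is at most d. *)
Lemma cross_proportional A B : holomorphic_curve A ->
  (forall z i j, cross (curve A (Some z)) (curve B (Some z)) i j = 0) ->
  exists c, B = c *: A.
Proof.
case=> nz sz h.
have fg i k : component A i * component B k = component B i * component A k.
  apply/eqP; rewrite -subr_eq0; apply/eqP/poly_eq0 => z.
  by have := h z i k; rewrite /cross !mxE !(hornerD, hornerM, hornerN).
have [i0 si0] : exists i0, size (component A i0) = d.+1.
  have : (0 < #|'I_4|)%N by rewrite card_ord.
  by case/(bigop.eq_bigmax (fun i => size (component A i))) => i0; rewrite sz => ->; exists i0.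
set f0 := component A i0 in si0; set g0 := component B i0.
have f00 : f0 != 0 by rewrite -size_poly_eq0 si0.
(* A root of f0 / gcdp f0 g0 would be a root of every component of A. *)
have dv : f0 %| g0.
  pose h0 := gcdp f0 g0; pose f1 := f0 %/ h0; pose g1 := g0 %/ h0.
  have h00 : h0 != 0 by rewrite gcdp_eq0 (negbTE f00).
  have f0E : f0 = f1 * h0 by rewrite divpK// dvdp_gcdl.
  have g0E : g0 = g1 * h0 by rewrite divpK// dvdp_gcdr.
  have cop : coprimep f1 g1 by apply: coprimep_div_gcd; rewrite f00.
  have dvk k : f1 %| component A k.
    rewrite -(Gauss_dvdpr _ cop); apply/dvdpP; exists (component B k).
    apply: (mulIf h00); rewrite mulrAC -g0E -fg -/f0 f0E; ring.
  have f10 : f1 != 0 by apply: contraNneq f00 => e; rewrite f0E e mul0r.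
  have [s1|s1] := eqVneq (size f1) 1%N.
    by rewrite f0E g0E dvdp_mul2r// (eqp_dvdl _ (_ : f1 %= 1)) ?dvd1p// -size_poly_eq1 s1.
  have /closed_rootP[z rz] := s1.
  have [k /negP[]] := nz z; move: rz; rewrite !root_factor_theorem => /dvdp_trans; apply.
  exact: dvk.
have [c gc] : exists c, g0 = c *: f0.
  have [q qE] := dvdpP _ _ dv; exists q`_0.
  have [q0|q0] := eqVneq q 0; first by rewrite qE q0 coef0 mul0r scale0r.
  have sg : (size g0 <= d.+1)%N by exact: size_poly.
  have sq : (size q <= 1)%N.
    by move: sg; rewrite qE size_mul// si0 addnS /= -[X in (_ <= X)%N]add1n leq_add2r.
  by rewrite -mul_polyC -(size1_polyC sq).
have BE i : component B i = c *: component A i.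
  by apply: (mulfI f00); rewrite fg -/g0 gc -scalerAl scalerAr.
by exists c; apply/matrixP => i k; rewrite -coef_component BE coefZ coef_component mxE.
Qed.
End Invariant.

(** * Continuity of complex-valued functions *)

Section Continuity.
Context {R : realType} {T : topologicalType}.
Local Notation C := R[i].

(** Continuity for the norm topology, which R[i] carries under the name R[i]^o. *)
Definition continuousC (f : T -> C) := continuous (f : T -> C^o).

Lemma continuousC_cst (a : C) : continuousC (fun=> a).
Proof. by move=> x; exact: cvg_cst. Qed.

Lemma continuousCD f g : continuousC f -> continuousC g -> continuousC (fun t => f t + g t).
Proof. by move=> hf hg x; apply: (@cvgD C C^o _ (nbhs x)); [exact: hf|exact: hg]. Qed.

Lemma continuousCN f : continuousC f -> continuousC (fun t => - f t).
Proof. by move=> hf x; apply: (@cvgN C C^o _ (nbhs x)); exact: hf. Qed.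

Lemma continuousCB f g : continuousC f -> continuousC g -> continuousC (fun t => f t - g t).
Proof. by move=> hf hg; exact: (continuousCD hf (continuousCN hg)). Qed.

Lemma continuousCM f g : continuousC f -> continuousC g -> continuousC (fun t => f t * g t).
Proof. by move=> hf hg x; apply: (@cvgM C T (nbhs x)); [exact: hf|exact: hg]. Qed.

Lemma continuousC_sum (I : finType) (f : I -> T -> C) :
  (forall i, continuousC (f i)) -> continuousC (fun t => \sum_i f i t).
Proof.
move=> h.
have -> : (fun t => \sum_i f i t) = \sum_i f i by apply/funext => t; rewrite fct_sumE.
by elim/big_ind : _ => [|g k hg hk|//]; [exact: continuousC_cst|exact: continuousCD].
Qed.

Lemma continuousCV f : continuousC f -> (forall t, f t != 0) -> continuousC (fun t => (f t)^-1).
Proof. by move=> hf f0 x; apply: (@cvgV C T (nbhs x)) => //; exact: hf. Qed.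

Lemma continuousC_conj f : continuousC f -> continuousC (fun t => (f t)^*).
Proof.
move=> hf x; apply: (@continuous_cvg _ C^o C^o (nbhs x) _ f Num.conj (f x)); last exact: hf.
move=> A /= /nbhs_ballP[e e0 he]; apply/nbhs_ballP; exists e => // y /= ye; apply: he.
by move: ye; rewrite /ball /= -rmorphB norm_conjC.
Qed.

Lemma continuousC_real (f : T -> R) : continuous f -> continuousC (fun t => (f t)%:C).
Proof.
move=> hf x; apply: (@continuous_cvg _ R C^o (nbhs x) _ f (real_complex R) (f x)); last exact: hf.
move=> A /= /nbhs_ballP[e e0 he].
have e0' : 0 < complex.Re e by move: e0; rewrite /= ltcE /= => /andP[].
have eE : e = (complex.Re e)%:C.
  by move: e0; rewrite /= ltcE => /andP[/eqP]; case: (e) => a b /= -> _.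
apply/nbhs_ballP; exists (complex.Re e) => // y /= ye; apply: he.
rewrite /ball /= eE -rmorphB; move: ye; rewrite /ball /= => ye.
by rewrite normc_def /= expr0n addr0 sqrtr_sqr ltcR.
Qed.

Lemma continuousC_closed_eq f g : continuousC f -> continuousC g -> closed [set t | f t = g t].
Proof.
move=> hf hg.
have -> : [set t | f t = g t] = (fun t => f t - g t : C^o) @^-1` [set 0].
  by apply/seteqP; split => t /=; [move=> ->; rewrite subrr|move/eqP; rewrite subr_eq0 => /eqP].
apply: preimage_closed; first by move=> x _; exact: (continuousCB hf hg).
exact: (accessible_closed_set1 (hausdorff_accessible (@norm_hausdorff _ C^o))).
Qed.

End Continuity.

(** * The closed conditions *)

Section ProjClosure.
Context {R : realType} {d : nat}.
Local Notation C := R[i].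

(** The first condition says that sigma A is proportional to A, in the form of
    polynomial equations. In degree 5 these two conditions describe the closure of
    the space of curves: see closure_limit_curve and limit_closure. *)
Definition limit_curve (A : 'M[C]_(4, d.+1)) : Prop :=
  (forall i j k l, sigma A i j * A k l = A i j * sigma A k l) /\
  forall z, omega (velocity A (Some z)) (curve A (Some z)) = 0.

Lemma continuousC_entry i j : continuousC (fun A : 'M[C^o]_(4, d.+1) => A i j).
Proof. exact: (@coord_continuous C). Qed.

Lemma continuousC_jv (T : topologicalType) (v : T -> 'cV[C]_4) :
  (forall j, continuousC (fun t => v t j 0)) -> forall j, continuousC (fun t => jv (v t) j 0).
Proof.
move=> h; have hc k : continuousC (fun t => (v t (inord k) 0)^*) by exact: continuousC_conj.
apply: (@forall4 (fun j => continuousC (fun t => jv (v t) j 0)));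
  under eq_fun do rewrite /jv /vec4 mxE inordK//=.
- by apply: continuousCN; exact: hc.
- exact: hc.
- by apply: continuousCN; exact: hc.
- exact: hc.
Qed.

Lemma continuousC_omega (T : topologicalType) (v w : T -> 'cV[C]_4) :
  (forall j, continuousC (fun t => v t j 0)) -> (forall j, continuousC (fun t => w t j 0)) ->
  continuousC (fun t => omega (v t) (w t)).
Proof.
move=> hv hw; rewrite /omega /coord.
by apply: continuousCD; apply: continuousCB; apply: continuousCM; [exact: hv|exact: hw|exact: hv|exact: hw|
  exact: hv|exact: hw|exact: hv|exact: hw].
Qed.

Lemma limit_curve_closed : closed [set A : 'M[C^o]_(4, d.+1) | limit_curve A].
Proof.
have hA i j : continuousC (fun A : 'M[C^o]_(4, d.+1) => A i j) by exact: continuousC_entry.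
have hs i j : continuousC (fun A : 'M[C^o]_(4, d.+1) => sigma A i j).
  under eq_fun do rewrite sigmaE; apply: continuousCM; first exact: continuousC_cst.
  by apply: (@continuousC_jv _ (fun A : 'M[C^o]_(4, d.+1) => col (rev_ord j) A)) => k; under eq_fun do rewrite mxE; exact: hA.
have hc z i : continuousC (fun A : 'M[C^o]_(4, d.+1) => curve A (Some z) i 0).
  under eq_fun do rewrite curveE summxE; apply: continuousC_sum => k.
  under eq_fun do rewrite !mxE; apply: continuousCM; [exact: continuousC_cst|exact: hA].
have hv z i : continuousC (fun A : 'M[C^o]_(4, d.+1) => velocity A (Some z) i 0).
  under eq_fun do rewrite velocityE summxE; apply: continuousC_sum => k.
  under eq_fun do rewrite !mxE; apply: continuousCM; [exact: continuousC_cst|exact: hA].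
rewrite (_ : [set A | _] =
    (\bigcap_(u : 'I_4 * 'I_d.+1 * 'I_4 * 'I_d.+1) [set A : 'M[C^o]_(4, d.+1) |
        sigma A u.1.1.1 u.1.1.2 * A u.1.2 u.2 = A u.1.1.1 u.1.1.2 * sigma A u.1.2 u.2]) `&`
    \bigcap_(z : C) [set A : 'M[C^o]_(4, d.+1) |
        omega (velocity A (Some z)) (curve A (Some z)) = 0]); last first.
  apply/seteqP; split => A /=.
    by move=> [h1 h2]; split => [[[[i j] k] l]|z] _ /=; [exact: h1|exact: h2].
  by move=> [h1 h2]; split => [i j k l|z]; [exact: (h1 (i, j, k, l) I)|exact: (h2 z I)].
apply: closedI; apply: closed_bigI => u _.
- by apply: continuousC_closed_eq; apply: continuousCM; [exact: hs|exact: hA|exact: hA|exact: hs].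
- by apply: continuousC_closed_eq; [apply: continuousC_omega; [exact: hv|exact: hc]|exact: continuousC_cst].
Qed.

Lemma sigmaZ c (A : 'M[C]_(4, d.+1)) : sigma (c *: A) = c^* *: sigma A.
Proof.
apply/matrixP => i k; rewrite [RHS]mxE !sigmaE.
have -> : col (rev_ord k) (c *: A) = c *: col (rev_ord k) A.
  by apply/matrixP => r s; rewrite !mxE.
by rewrite jvZ mxE mulrCA.
Qed.

Lemma curveZ c (A : 'M[C]_(4, d.+1)) z : curve (c *: A) (Some z) = c *: curve A (Some z).
Proof.
rewrite !curveE scaler_sumr; apply: eq_bigr => k _.
by apply/matrixP => i j; rewrite !mxE mulrCA.
Qed.

Lemma velocityZ c (A : 'M[C]_(4, d.+1)) z :
  velocity (c *: A) (Some z) = c *: velocity A (Some z).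
Proof.
rewrite !velocityE scaler_sumr; apply: eq_bigr => k _.
by apply/matrixP => i j; rewrite !mxE mulrCA.
Qed.

Lemma limit_curveZ c (A : 'M[C]_(4, d.+1)) : limit_curve A -> limit_curve (c *: A).
Proof.
move=> [h1 h2]; split => [i j k l|z].
  have eM a (B : 'M[C]_(4, d.+1)) r s : (a *: B) r s = a * B r s by rewrite mxE.
  by have e := h1 i j k l; rewrite sigmaZ !eM; ring: e.
have omegaZr a x y : omega x (a *: y) = a * omega x y :> C by rewrite /omega !coordE; ring.
by rewrite curveZ velocityZ omegaZl omegaZr h2 !mulr0.
Qed.

Lemma AHHol_limit_curve (A : 'M[C]_(4, d.+1)) : holomorphic_curve A ->
  linearly_full A -> horizontal A -> antipodally_invariant A -> limit_curve A.
Proof.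
move=> hA lA zA aA.
have [|c cE] := @cross_proportional _ _ A (sigma A) hA.
  by move=> z i j; exact: antipodal_cross.
split=> [i j k l|z]; last by apply: horizontal_omega => //; exact: holomorphic_neq0.
by rewrite cE !mxE; ring.
Qed.

Lemma closure_limit_curve (x : proj_space R d) : AHHol_LF_le R d x ->
  exists2 A : @punctured R d, limit_curve (val A) & x = proj_point A.
Proof.
pose X : set (proj_space R d) := (@proj_point R d) @` [set A : @punctured R d | limit_curve (val A)].
have cX : closed X.
  have preX : (@proj_point R d) @^-1` X = [set A : @punctured R d | limit_curve (val A)].
    apply/seteqP; split => A; last by exists A.
    move=> [B hB BA]; have : proportional B A.
      by apply/eqmodP; exact: BA.
    by move=> /asboolP[c c0 e]; exact: (eq_ind_r limit_curve (limit_curveZ c hB) e).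
  rewrite -openC /open /= /quotient_open.
  change (open (~` ((@proj_point R d) @^-1` X))); rewrite preX openC.
  apply: (@preimage_closed (@punctured R d) 'M[C^o]_(4, d.+1) set_val
    [set A | limit_curve A]); last exact: limit_curve_closed.
  by move=> A _; exact: initial_continuous.
have sX : AHHol_LF R d `<=` X.
  move=> _ [A [h1 h2 h3 h4] <-]; exists A => //; exact: AHHol_limit_curve.
rewrite /AHHol_LF_le closureE => /(_ X) [|A hA <-]; first by split.
by exists A.
Qed.

End ProjClosure.

(** * Real curves of degree five *)

Section RealCurve.
Context {R : realType}.
Local Notation C := R[i].
Implicit Types (a b c v x y : 'cV[C]_4) (A : 'M[C]_(4, 6)).

(** The general fixed point of sigma in degree 5; see sigma_fixed. *)
Definition real_curve a b c : 'M[C]_(4, 6) :=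
  \matrix_(i, k) nth a [:: a; b; c; jv c; - jv b; jv a] k i 0.

Lemma forall6 (P : 'I_6 -> Prop) : P (inord 0) -> P (inord 1) -> P (inord 2) ->
  P (inord 3) -> P (inord 4) -> P (inord 5) -> forall k, P k.
Proof.
move=> p0 p1 p2 p3 p4 p5 k; rewrite -[k]inord_val.
by case: k => [[|[|[|[|[|[|//]]]]]] h].
Qed.

Lemma sum6 (V : nmodType) (F : 'I_6 -> V) : \sum_k F k =
  F (inord 0) + F (inord 1) + F (inord 2) + F (inord 3) + F (inord 4) + F (inord 5).
Proof.
rewrite !big_ord_recr big_ord0 /= add0r.
by congr (_ + _ + _ + _ + _ + _); congr F; apply/val_inj; rewrite /= inordK.
Qed.

Lemma col_real_curve a b c k : col k (real_curve a b c) = nth a [:: a; b; c; jv c; - jv b; jv a] k.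
Proof. by apply/matrixP => i j; rewrite ord1 !mxE. Qed.

Lemma col_inj (m n : nat) (A B : 'M[C]_(m, n)) : (forall k, col k A = col k B) -> A = B.
Proof. by move=> h; apply/matrixP => i k; have /matrixP/(_ i 0) := h k; rewrite !mxE. Qed.

Lemma jvN v : jv (- v) = - jv v.
Proof. by rewrite -scaleN1r jvZ rmorphN rmorph1 scaleN1r. Qed.

Lemma rev_inord k : (k < 6)%N -> rev_ord (inord k) = inord (5 - k) :> 'I_6.
Proof. by move=> k6; apply/val_inj; rewrite /= !inordK// ltnS leq_subr. Qed.

Lemma sigma_real_curve a b c : sigma (real_curve a b c) = real_curve a b c.
Proof.
apply: col_inj; apply: forall6; rewrite col_sigma rev_inord// !col_real_curve !inordK//= ?jvN ?jvK ?exprS ?expr0;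
  rewrite ?mulr1 ?mulN1r ?opprK ?scaleN1r ?scale1r ?opprK//.
Qed.

Lemma sigma_fixed A : sigma A = A ->
  A = real_curve (col (inord 0) A) (col (inord 1) A) (col (inord 2) A).
Proof.
move=> sA; apply: col_inj; apply: forall6; rewrite col_real_curve !inordK//=;
 rewrite -{1}sA col_sigma rev_inord// ?inordK//= ?exprS ?expr0;
 by rewrite ?mulr1 ?mulN1r ?opprK ?scaleN1r ?scale1r.
Qed.

Lemma curve_real_curve a b c z : curve (real_curve a b c) (Some z) =
  a + z *: b + z ^+ 2 *: c + z ^+ 3 *: jv c - z ^+ 4 *: jv b + z ^+ 5 *: jv a.
Proof.
by rewrite curveE sum6 !col_real_curve !inordK//= expr0 expr1 scale1r scalerN.
Qed.

Lemma velocity_real_curve a b c z : velocity (real_curve a b c) (Some z) =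
  b + (2 * z) *: c + (3 * z ^+ 2) *: jv c - (4 * z ^+ 3) *: jv b + (5 * z ^+ 4) *: jv a.
Proof.
rewrite velocityE sum6 !col_real_curve !inordK//= mulr0n scale0r add0r !mulr_natl.
by rewrite expr0 expr1 mulr1n scale1r scalerN.
Qed.

Lemma velocity_real_curve_inf a b c : velocity (real_curve a b c) None = - jv b.
Proof.
have <- : col (inord 4) (real_curve a b c) = - jv b by rewrite col_real_curve inordK.
apply/matrixP => i j; rewrite ord1 [LHS]mxE horner_coef0 coef_deriv mulr1n.
have := coef_component (inverted_chart (real_curve a b c)) i (inord 1).
rewrite inordK// => ->; rewrite [LHS]mxE rev_inord// [RHS]mxE.
by [].
Qed.

(** The coefficients of degrees 0 to 4 of omega f' f, up to constant factors, when
    f is real_curve a b c; see omega_real_curve. *)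
Definition hor_triple a b c : Prop :=
  [/\ omega a b = 0, omega a c = 0, 3 * hdot a c + omega b c = 0,
      hdot b c = 2 * hdot a b & 5 * hdot a a + hdot c c = 3 * hdot b b].

Lemma conj_hdot x y : (hdot x y)^* = hdot y x.
Proof. by rewrite !hdotE !(rmorphD, rmorphM) /= !conjCK; ring. Qed.

Lemma omega_real_curve a b c z :
  omega (velocity (real_curve a b c) (Some z)) (curve (real_curve a b c) (Some z)) =
  - (omega a b + 2 * omega a c * z + (3 * hdot a c + omega b c) * z ^+ 2
  + 2 * (hdot b c - 2 * hdot a b) * z ^+ 3
  + (5 * hdot a a + hdot c c - 3 * hdot b b) * z ^+ 4
  - 2 * (hdot b c - 2 * hdot a b)^* * z ^+ 5
  + (3 * hdot a c + omega b c)^* * z ^+ 6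
  - 2 * (omega a c)^* * z ^+ 7 + (omega a b)^* * z ^+ 8).
Proof.
have -> : (hdot b c - 2 * hdot a b)^* = hdot c b - 2 * hdot b a.
  by rewrite rmorphB rmorphM rmorph_nat /= !conj_hdot.
have -> : (3 * hdot a c + omega b c)^* = 3 * hdot c a + (omega b c)^*.
  by rewrite rmorphD rmorphM rmorph_nat /= !conj_hdot.
have oC x y : (omega x y)^* = (coord x 0)^* * (coord y 1)^* - (coord x 1)^* * (coord y 0)^* +
  ((coord x 2)^* * (coord y 3)^* - (coord x 3)^* * (coord y 2)^*).
  by rewrite /omega rmorphD !rmorphB !rmorphM.
rewrite curve_real_curve velocity_real_curve !oC !hdotE /omega !coordE.
move: (coord a 0) (coord a 1) (coord a 2) (coord a 3) => a0 a1 a2 a3.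
move: (coord b 0) (coord b 1) (coord b 2) (coord b 3) => b0 b1 b2 b3.
move: (coord c 0) (coord c 1) (coord c 2) (coord c 3) => c0 c1 c2 c3.
ring.
Qed.

Lemma hor_tripleP a b c : hor_triple a b c <->
  forall z, omega (velocity (real_curve a b c) (Some z)) (curve (real_curve a b c) (Some z)) = 0.
Proof.
split=> [[h1 h2 h3 h4 h5] z|h].
  by rewrite omega_real_curve h1 h2 h3 h4 h5 !subrr !rmorph0; ring.
pose e := [:: omega a b; 2 * omega a c; 3 * hdot a c + omega b c;
  2 * (hdot b c - 2 * hdot a b); 5 * hdot a a + hdot c c - 3 * hdot b b;
  - (2 * (hdot b c - 2 * hdot a b)^*); (3 * hdot a c + omega b c)^*;
  - (2 * (omega a c)^*); (omega a b)^*].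
have /polyP e0 : Poly e = 0.
  apply: poly_eq0 => z; have := h z; rewrite omega_real_curve => /eqP; rewrite oppr_eq0 => /eqP.
  by move=> hz; rewrite -[RHS]hz horner_Poly /=; ring.
(* The coefficients of degree 5 to 8 repeat the first four, conjugated. *)
have n2 : (2 : C) != 0 by rewrite pnatr_eq0.
split.
- by have := e0 0%N; rewrite coef_Poly coef0.
- by have := e0 1%N; rewrite coef_Poly coef0 /= => /eqP; rewrite mulf_eq0 (negbTE n2) => /eqP.
- by have := e0 2%N; rewrite coef_Poly coef0.
- have := e0 3%N; rewrite coef_Poly coef0 /= => /eqP; rewrite mulf_eq0 (negbTE n2) /= subr_eq0.
  by move/eqP.
- by have := e0 4%N; rewrite coef_Poly coef0 /= => /eqP; rewrite subr_eq0 => /eqP.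
Qed.

End RealCurve.

(** * Paths in Sp(2) *)

Section Symplectic.
Context {R : realType}.
Local Notation C := R[i].
Implicit Types (u v x y : 'cV[C]_4) (M N : 'M[C]_4).

(** The compact group Sp(2): the unitary matrices that commute with jv. *)
Definition symplectic M := (forall v, jv (M *m v) = M *m jv v) /\
  (forall x y, hdot (M *m x) (M *m y) = hdot x y).

Lemma symplecticM M N : symplectic M -> symplectic N -> symplectic (M *m N).
Proof. by move=> [jM hM] [jN hN]; split=> *; rewrite -!mulmxA ?jM ?jN ?hM ?hN. Qed.

Lemma symplectic_omega M x y : symplectic M -> omega (M *m x) (M *m y) = omega x y.
Proof.
move=> [jM hM]; apply: oppr_inj; rewrite -[in RHS]hdot_jv -[in RHS]hM -jM.
by rewrite hdot_jv.
Qed.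

Lemma symplectic_hor_triple M a b c : symplectic M ->
  hor_triple (M *m a) (M *m b) (M *m c) <-> hor_triple a b c.
Proof. by move=> sM; rewrite /hor_triple !(symplectic_omega _ _ sM) !(proj2 sM). Qed.

Lemma symplectic_real_curve M a b c : symplectic M ->
  M *m real_curve a b c = real_curve (M *m a) (M *m b) (M *m c).
Proof.
move=> [jM _]; apply: col_inj => k; rewrite col_real_curve colE -mulmxA -colE col_real_curve.
by case: k => [[|[|[|[|[|[|//]]]]]] h]; rewrite /= ?jM ?mulmxN.
Qed.

(** The H-linear map that sends the standard basis of H^2 to u and v. *)
Definition quat_mx u v : 'M[C]_4 := \matrix_(i, j) nth u [:: u; jv u; v; jv v] j i 0.

Lemma quat_mxE u v x : quat_mx u v *m x =
  coord x 0 *: u + coord x 1 *: jv u + coord x 2 *: v + coord x 3 *: jv v.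
Proof.
rewrite /quat_mx; move: (jv u) (jv v) => ju jv'.
apply/matrixP => i j; rewrite ord1 !mxE sum4 !mxE !inordK//= /coord.
ring.
Qed.

Lemma hdotDl x y v : hdot (x + y) v = hdot x v + hdot y v.
Proof. by rewrite !hdotE !coordE; ring. Qed.
Lemma hdotZl a x v : hdot (a *: x) v = a * hdot x v.
Proof. by rewrite !hdotE !coordE; ring. Qed.
Lemma hdotDr x y v : hdot v (x + y) = hdot v x + hdot v y.
Proof. by rewrite !hdotE !coordE !rmorphD; ring. Qed.
Lemma hdotZr a x v : hdot v (a *: x) = a^* * hdot v x.
Proof. by rewrite !hdotE !coordE !rmorphM; ring. Qed.

Lemma hdot_jv2 x y : hdot (jv x) (jv y) = hdot y x.
Proof. by rewrite !hdotE /jv !coordE !rmorphN /= !conjCK; ring. Qed.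
Lemma omegaC x y : omega x y = - omega y x.
Proof. by rewrite /omega; ring. Qed.
Lemma hdot_jvl x y : hdot (jv x) y = (omega x y)^*.
Proof. by rewrite -conj_hdot hdot_jv omegaC opprK. Qed.
Lemma omega_self x : omega x x = 0.
Proof. by rewrite /omega; ring. Qed.

Lemma coord_jv x : (coord (jv x) 0 = - (coord x 1)^*) * (coord (jv x) 1 = (coord x 0)^*)
  * (coord (jv x) 2 = - (coord x 3)^*) * (coord (jv x) 3 = (coord x 2)^*).
Proof. by rewrite /jv !coord_vec4. Qed.

Lemma symplectic_quat_mx u v : hdot u u = 1 -> hdot v v = 1 -> hdot u v = 0 -> omega u v = 0 ->
  symplectic (quat_mx u v).
Proof.
move=> uu vv uv ov.
have vu : hdot v u = 0 by rewrite -conj_hdot uv conjC0.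
split=> [x|x y]; rewrite !quat_mxE.
  rewrite !jvD !jvZ !jvK !coord_jv; move: (jv u) (jv v) => ju jv'.
  by apply/matrixP => i j; rewrite !mxE; ring.
rewrite !hdotDl !hdotDr !hdotZl !hdotZr !hdot_jv2 !hdot_jv !hdot_jvl.
rewrite !omega_self uu vv uv vu ov [omega v u]omegaC ov oppr0 conjC0 hdotE; ring.
Qed.

(** A path in Sp(2) from the identity to M. The path of inverses, which ends at
    M', is recorded as well: it is the one that moves curves. *)
Definition symplectic_path M M' := exists m n : R -> 'M[C]_4,
  [/\ forall i j, continuousC (fun t => m t i j), forall i j, continuousC (fun t => n t i j),
      forall t, [/\ symplectic (m t), symplectic (n t), m t *m n t = 1%:M & n t *m m t = 1%:M],
      m 0 = 1%:M /\ n 0 = 1%:M & m 1 = M /\ n 1 = M'].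

Lemma continuousC_mulmx m n p (T : topologicalType) (f : T -> 'M[C]_(m, n)) (g : T -> 'M[C]_(n, p)) :
  (forall i j, continuousC (fun t => f t i j)) -> (forall i j, continuousC (fun t => g t i j)) ->
  forall i j, continuousC (fun t => (f t *m g t) i j).
Proof.
move=> hf hg i j; under eq_fun do rewrite mxE.
by apply: continuousC_sum => k; apply: continuousCM; [exact: hf|exact: hg].
Qed.

Lemma symplectic_pathM M M' N N' :
  symplectic_path M M' -> symplectic_path N N' ->
  symplectic_path (M *m N) (N' *m M').
Proof.
move=> [m [m' [cm cm' sm [m0 m'0] [m1 m'1]]]] [n [n' [cn cn' sn [n0 n'0] [n1 n'1]]]].
exists (fun t => m t *m n t), (fun t => n' t *m m' t).
split; [exact: continuousC_mulmx|exact: continuousC_mulmx| | |].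
- move=> t; have [s1 s2 s3 s4] := sm t; have [t1 t2 t3 t4] := sn t.
  split; [exact: symplecticM|exact: symplecticM| |].
    by rewrite mulmxA -(mulmxA (m t)) t3 mulmx1 s3.
  by rewrite mulmxA -(mulmxA (n' t)) s4 mulmx1 t4.
- by rewrite m0 n0 m'0 n'0 !mulmx1.
- by rewrite m1 n1 m'1 n'1.
Qed.

Definition unit2 (a b : C) := sqnormc a + sqnormc b = 1.

Lemma unit2E a b : unit2 a b <-> a * a^* + b * b^* = 1.
Proof.
rewrite -!sqnormcE -rmorphD; split=> [->|/complexI//]; by rewrite rmorph1.
Qed.

Lemma addC_conj (z : C) : z + z^* = (2 * complex.Re z)%:C.
Proof.
by case: z => x y; rewrite -[_^*]/(conjc _) /=; simpc; rewrite mulr_natl mulr2n.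
Qed.

(** The segment from (1, 0) to (a, b) avoids the origin unless (a, b) = (-1, 0);
    divide it by its norm, whose square is q. *)
Lemma unit2_path a b : unit2 a b -> a <> -1 -> exists f g : R -> C,
  [/\ continuousC f, continuousC g, forall t, unit2 (f t) (g t), f 0 = 1 /\ g 0 = 0 &
      f 1 = a /\ g 1 = b].
Proof.
move=> u1 an1.
pose k := complex.Re a; pose q (t : R) := (1 - t) ^+ 2 + 2 * t * (1 - t) * k + t ^+ 2.
have sqD (z : C) : sqnormc z = complex.Re z ^+ 2 + complex.Im z ^+ 2.
  by case: z => x y; rewrite /sqnormc /= sqr_sqrtr// addr_ge0 ?sqr_ge0.
have u1' : k ^+ 2 + complex.Im a ^+ 2 + sqnormc b = 1 by rewrite -sqD.
have sb : 0 <= sqnormc b := sqnormc_ge0 b.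
have k1 : k <= 1 by nra.
have kn1 : -1 < k.
  have kge : -1 <= k by nra.
  rewrite lt_neqAle kge andbT; apply/negP => /eqP ek; apply: an1.
  have i0 : complex.Im a = 0 by apply/eqP; rewrite -sqrf_eq0; apply/eqP; nra.
  by rewrite [a]complexE i0 -/k -ek rmorph0 mulr0 addr0 rmorphN rmorph1.
have q0 t : 0 < q t.
  have qE : q t = (1 + k) / 2 + 2 * ((1 - k) * (t - 2^-1) ^+ 2) by rewrite /q; field.
  have : 0 <= (1 - k) * (t - 2^-1) ^+ 2 by rewrite mulr_ge0 ?sqr_ge0 ?subr_ge0.
  by move: ((1 - k) * (t - 2^-1) ^+ 2) qE => y; lra.
have cq : continuous (fun t => (Num.sqrt (q t))^-1).
  have cqq : continuous q.
    have -> : q = horner ((1 - 'X) ^+ 2 + 2 *: 'X * (1 - 'X) * k%:P + 'X ^+ 2).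
      by apply/funext => t; rewrite !(hornerE, horner_exp).
    exact: continuous_horner.
  move=> t; apply: cvgV; first by rewrite gt_eqF// sqrtr_gt0.
  by apply: continuous_cvg; [exact: sqrt_continuous|exact: cqq].
have cs := continuousC_real cq.
have cid : continuous (fun t : R => t) by move=> t; exact: cvg_id.
have ct := continuousC_real cid.
have s2 t : ((Num.sqrt (q t))^-1)%:C * ((Num.sqrt (q t))^-1)%:C *
    ((1 - t%:C) ^+ 2 + t%:C * (1 - t%:C) * (a + a^*) + t%:C ^+ 2) = 1.
  have -> : a + a^* = (2 * k)%:C by exact: addC_conj.
  have -> : (1 - t%:C) ^+ 2 + t%:C * (1 - t%:C) * (2 * k)%:C + t%:C ^+ 2 = (q t)%:C.
    by rewrite /q !(rmorphD, rmorphB, rmorphM, rmorphXn) rmorph1; ring.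
  rewrite -!rmorphM -expr2 exprVn sqr_sqrtr ?mulVf ?rmorph1//; first by rewrite gt_eqF.
  exact: ltW.
exists (fun t => ((Num.sqrt (q t))^-1)%:C * (1 - t%:C + t%:C * a)),
  (fun t => ((Num.sqrt (q t))^-1)%:C * (t%:C * b)); split.
- apply: continuousCM; first exact: cs.
  apply: continuousCD; first by apply: continuousCB; [exact: continuousC_cst|exact: ct].
  by apply: continuousCM; [exact: ct|exact: continuousC_cst].
- apply: continuousCM; first exact: cs.
  by apply: continuousCM; [exact: ct|exact: continuousC_cst].
- move=> t; apply/unit2E; move/unit2E: u1 => u1.
  rewrite !(rmorphM, rmorphD, rmorphN) /= !conj_real rmorph1 -[RHS](s2 t).
  have bb : b * b^* = 1 - a * a^* by rewrite -u1 addrC addKr. ring: bb.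
- have -> : q 0 = 1 by rewrite /q; ring.
  by rewrite sqrtr1 invr1 rmorph1 rmorph0 !mul0r mulr0 subr0 addr0 mulr1.
- have -> : q 1 = 1 by rewrite /q; ring.
  by rewrite sqrtr1 invr1 rmorph1 subrr add0r !mul1r.
Qed.

End Symplectic.

(** * Generators of Sp(2) *)

Section Generators.
Context {R : realType}.
Local Notation C := R[i].
Implicit Types (u v x y : 'cV[C]_4) (M N : 'M[C]_4).

Lemma unit2_sub (a b : C) : unit2 a b -> b * b^* = 1 - a * a^*.
Proof. by move=> /unit2E <-; rewrite addrC addKr. Qed.

Lemma unit2_inv (a b : C) : unit2 a b -> unit2 a^* (- b).
Proof. by move=> /unit2E h; apply/unit2E; rewrite -[RHS]h rmorphN conjCK; ring. Qed.

(** For (a, b) distinct from (-1, 0) the path comes from unit2_path, and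
    G (- 1) 0 is the square of G 'i 0. *)
Lemma symplectic_path_family (G : C -> C -> 'M[C]_4) : G 1 0 = 1%:M ->
  (forall a b, unit2 a b -> symplectic (G a b)) ->
  (forall a b, unit2 a b -> G a b *m G a^* (- b) = 1%:M) ->
  (forall a b : R -> C, continuousC a -> continuousC b ->
    forall i j, continuousC (fun t => G (a t) (b t) i j)) ->
  G 'i%C 0 *m G 'i%C 0 = G (- 1) 0 ->
  forall a b, unit2 a b -> exists M', symplectic_path (G a b) M'.
Proof.
move=> G1 Gs Gi Gc Gm.
have H a b : unit2 a b -> a <> -1 -> symplectic_path (G a b) (G a^* (- b)).
  move=> u1 an1; have [f [g [cf cg ug [f0 g0] [f1 g1]]]] := unit2_path u1 an1.
  exists (fun t => G (f t) (g t)), (fun t => G (f t)^* (- g t)).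
  split; [exact: Gc|apply: Gc; [exact: continuousC_conj|exact: continuousCN]| | |].
  - move=> t; split; [exact: Gs|exact/Gs/unit2_inv|exact: Gi|].
    by have := Gi _ _ (unit2_inv (ug t)); rewrite conjCK opprK.
  - by rewrite f0 g0 conjC1 oppr0.
  - by rewrite f1 g1.
move=> a b u1; have [an1|an1] := pselect (a = -1); last by exists (G a^* (- b)); exact: H.
have b0 : b = 0.
  move: u1; rewrite an1 => /unit2E; rewrite rmorphN rmorph1 mulrNN mulr1 -[RHS]addr0 => /addrI.
  by rewrite -sqnormcE => /(@complexI R _ 0)/eqP; rewrite sqnormc_eq0 => /eqP.
rewrite an1 b0 -Gm.
have ui : unit2 'i%C (0 : C).
  by apply/unit2E; rewrite -[X in 'i%C * X]/(conjc _) /=; simpc.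
have hi : symplectic_path (G 'i%C 0) (G 'i%C^* (- 0)).
  by apply: H => // /(congr1 (@complex.Im R)) /= /eqP; rewrite oppr0 oner_eq0.
by exists (G 'i%C^* (- 0) *m G 'i%C^* (- 0)); exact: symplectic_pathM.
Qed.

(** Unit quaternions act on the first coordinate of H^2 by gen1 and on the second
    one by gen2, while gen3 mixes the two coordinates by a unitary 2 x 2 matrix. *)
Definition gen1 (a b : C) := quat_mx (vec4 a b 0 0) (vec4 0 0 1 0).
Definition gen2 (a b : C) := quat_mx (vec4 1 0 0 0) (vec4 0 0 a b).
Definition gen3 (a b : C) := quat_mx (vec4 a 0 b 0) (vec4 (- b^*) 0 a^* 0).

Lemma gen1E a b x : gen1 a b *m x = vec4 (a * coord x 0 - b^* * coord x 1)
  (b * coord x 0 + a^* * coord x 1) (coord x 2) (coord x 3).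
Proof.
by apply: coordP; rewrite quat_mxE !coordE /= ?(conjC0, conjC1, oppr0, mulr0, mulr1, addr0, add0r); ring.
Qed.

Lemma gen2E a b x : gen2 a b *m x = vec4 (coord x 0) (coord x 1)
  (a * coord x 2 - b^* * coord x 3) (b * coord x 2 + a^* * coord x 3).
Proof.
by apply: coordP; rewrite quat_mxE !coordE /= ?(conjC0, conjC1, oppr0, mulr0, mulr1, addr0, add0r); ring.
Qed.

Lemma gen3E a b x : gen3 a b *m x = vec4 (a * coord x 0 - b^* * coord x 2)
  (a^* * coord x 1 - b * coord x 3) (b * coord x 0 + a^* * coord x 2)
  (b^* * coord x 1 + a * coord x 3).
Proof.
by apply: coordP; rewrite quat_mxE !coordE /= ?(conjC0, oppr0, rmorphN) /= ?(conjCK, mulr0, addr0, add0r); ring.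
Qed.

Lemma mx_ext M N : (forall x : 'cV[C]_4, M *m x = N *m x) -> M = N.
Proof. by move=> h; apply: col_inj => k; rewrite !colE. Qed.

Lemma continuousC_quat_mx (u v : R -> 'cV[C]_4) :
  (forall j, continuousC (fun t => u t j 0)) -> (forall j, continuousC (fun t => v t j 0)) ->
  forall i j, continuousC (fun t => quat_mx (u t) (v t) i j).
Proof.
move=> hu hv i; apply: (@forall4 (fun j => continuousC (fun t => quat_mx (u t) (v t) i j)));
  under eq_fun do rewrite mxE inordK//=.
- exact: hu.
- exact: continuousC_jv.
- exact: hv.
- exact: continuousC_jv.
Qed.

Lemma continuousC_vec4 (a b c d : R -> C) :
  continuousC a -> continuousC b -> continuousC c -> continuousC d ->
  forall j, continuousC (fun t => vec4 (a t) (b t) (c t) (d t) j 0).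
Proof.
move=> ha hb hc hd; apply: (@forall4 (fun j => continuousC (fun t => vec4 (a t) (b t) (c t) (d t) j 0)));
  under eq_fun do rewrite mxE inordK//=.
- exact: ha.
- exact: hb.
- exact: hc.
- exact: hd.
Qed.

Let c0 : continuousC (fun _ : R => 0 : C). Proof. exact: continuousC_cst. Qed.
Let c1 : continuousC (fun _ : R => 1 : C). Proof. exact: continuousC_cst. Qed.

Lemma symplectic_path_gen1 a b : unit2 a b -> exists M', symplectic_path (gen1 a b) M'.
Proof.
apply: symplectic_path_family.
- by apply: mx_ext => x; rewrite gen1E mul1mx; apply: coordP; rewrite !coordE ?conjC0 ?conjC1; ring.
- move=> {}a {}b /unit2_sub u1; apply: symplectic_quat_mx; rewrite ?hdotE /omega !coordE ?conjC0 ?conjC1; by ring: u1.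
- move=> {}a {}b /unit2_sub u1; apply: mx_ext => x; rewrite -mulmxA !gen1E mul1mx.
  by apply: coordP; rewrite !coordE ?rmorphN /= ?conjCK; ring: u1.
- move=> f g cf cg; apply: continuousC_quat_mx; [exact: (continuousC_vec4 cf cg c0 c0)|exact: (continuousC_vec4 c0 c0 c1 c0)].
- have ii : 'i%C * 'i%C = -1 :> C by rewrite -expr2 sqr_i.
  have iC : ('i%C : C)^* = - 'i%C by rewrite -[LHS]/(conjc _) /=; simpc.
  apply: mx_ext => x; rewrite -mulmxA !gen1E.
  by apply: coordP; rewrite !coordE ?iC ?rmorphN ?conjC0 ?conjC1; ring: ii.
Qed.

Lemma symplectic_path_gen2 a b : unit2 a b -> exists M', symplectic_path (gen2 a b) M'.
Proof.
apply: symplectic_path_family.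
- by apply: mx_ext => x; rewrite gen2E mul1mx; apply: coordP; rewrite !coordE ?conjC0 ?conjC1; ring.
- move=> {}a {}b /unit2_sub u1; apply: symplectic_quat_mx; rewrite ?hdotE /omega !coordE ?conjC0 ?conjC1;
    by ring: u1.
- move=> {}a {}b /unit2_sub u1; apply: mx_ext => x; rewrite -mulmxA !gen2E mul1mx.
  by apply: coordP; rewrite !coordE ?rmorphN /= ?conjCK; ring: u1.
- move=> f g cf cg; apply: continuousC_quat_mx; [exact: (continuousC_vec4 c1 c0 c0 c0)|exact: (continuousC_vec4 c0 c0 cf cg)].
- have ii : 'i%C * 'i%C = -1 :> C by rewrite -expr2 sqr_i.
  have iC : ('i%C : C)^* = - 'i%C by rewrite -[LHS]/(conjc _) /=; simpc.
  apply: mx_ext => x; rewrite -mulmxA !gen2E.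
  by apply: coordP; rewrite !coordE ?iC ?rmorphN ?conjC0 ?conjC1; ring: ii.
Qed.

Lemma symplectic_path_gen3 a b : unit2 a b -> exists M', symplectic_path (gen3 a b) M'.
Proof.
apply: symplectic_path_family.
- by apply: mx_ext => x; rewrite gen3E mul1mx; apply: coordP; rewrite !coordE ?conjC0 ?conjC1; ring.
- move=> {}a {}b /unit2_sub u1; apply: symplectic_quat_mx; rewrite ?hdotE /omega !coordE ?conjC0 ?rmorphN /= ?conjCK;
    by ring: u1.
- move=> {}a {}b /unit2_sub u1; apply: mx_ext => x; rewrite -mulmxA !gen3E mul1mx.
  by apply: coordP; rewrite !coordE ?rmorphN /= ?conjCK; ring: u1.
- move=> f g cf cg; apply: continuousC_quat_mx; [exact: (continuousC_vec4 cf c0 cg c0)|].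
  exact: (continuousC_vec4 (continuousCN (continuousC_conj cg)) c0 (continuousC_conj cf) c0).
- have ii : 'i%C * 'i%C = -1 :> C by rewrite -expr2 sqr_i.
  have iC : ('i%C : C)^* = - 'i%C by rewrite -[LHS]/(conjc _) /=; simpc.
  apply: mx_ext => x; rewrite -mulmxA !gen3E.
  by apply: coordP; rewrite !coordE ?iC ?rmorphN ?conjC0 ?conjC1; ring: ii.
Qed.

(** The pair (a, b) is (x^*, - y), normalized. *)
Lemma rotate2 (x y : C) : exists a b, exists2 rho : R, 0 <= rho &
  [/\ unit2 a b, a * x - b^* * y = rho%:C & b * x + a^* * y = 0].
Proof.
pose n := sqnormc x + sqnormc y.
have n0 : 0 <= n by rewrite addr_ge0 ?sqnormc_ge0.
have [n1|n1] := eqVneq n 0.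
  have [x0 y0] : x = 0 /\ y = 0.
    move/eqP: n1; rewrite paddr_eq0 ?sqnormc_ge0// !sqnormc_eq0 => /andP[/eqP -> /eqP ->].
    by [].
  exists 1, 0, 0 => //; split; last by rewrite x0 y0; ring.
    by apply/unit2E; rewrite conjC1 conjC0; ring.
  by rewrite x0 y0 rmorph0; ring.
have r0 : Num.sqrt n != 0 by rewrite sqrtr_eq0 -ltNge lt_neqAle eq_sym n1.
pose r := (Num.sqrt n)%:C.
have rr : r * r = x * x^* + y * y^*.
  by rewrite -rmorphM -expr2 sqr_sqrtr// rmorphD /= !sqnormcE.
have rn : r != 0 by rewrite (inj_eq (@complexI R)).
exists (x^* / r), (- y / r), (Num.sqrt n); first exact: sqrtr_ge0.
have rC : r^* = r by exact: conj_real.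
rewrite -/r; split.
- apply/unit2E; rewrite !rmorphM !fmorphV rmorphN /= conjCK rC.
  by have -> : x^* / r * (x / r) + - y / r * (- y^* / r) = (x * x^* + y * y^*) / (r * r);
    [field|rewrite -rr divff// mulf_neq0].
- rewrite !rmorphM fmorphV rmorphN /= rC.
  have -> : x^* / r * x - - y^* / r * y = (x * x^* + y * y^*) / r by field.
  by rewrite -rr mulfK.
- by rewrite !rmorphM fmorphV /= conjCK rC; field.
Qed.

(** Givens elimination: gen1 and gen2 make the two quaternionic coordinates of v
    real, and gen3 then cancels the second one. *)
Lemma symplectic_path_normalize v : exists M M', symplectic_path M M' /\
  exists2 r : R, 0 <= r & M *m v = vec4 r%:C 0 0 0.
Proof.
have [a1 [b1 [r1 r10 [u1 e1 f1]]]] := rotate2 (coord v 0) (coord v 1).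
have [a2 [b2 [r2 r20 [u2 e2 f2]]]] := rotate2 (coord v 2) (coord v 3).
have [a3 [b3 [r3 r30 [u3 e3 f3]]]] := rotate2 r1%:C r2%:C.
have [M1 s1] := symplectic_path_gen1 u1; have [M2 s2] := symplectic_path_gen2 u2.
have [M3 s3] := symplectic_path_gen3 u3.
exists (gen3 a3 b3 *m (gen2 a2 b2 *m gen1 a1 b1)); eexists; split.
  exact: symplectic_pathM s3 (symplectic_pathM s2 s1).
exists r3 => //; rewrite -!mulmxA gen1E gen2E gen3E !coordE e1 e2 f1 f2 !mulr0 e3 f3.
by rewrite subr0 addr0.
Qed.

End Generators.

(** * Standard horizontal curves *)

Section NormalForm.
Context {R : realType}.
Local Notation C := R[i].
Implicit Types (r : R) (b c : C).

(** For a triple of the form (r, 0, 0, 0), (b, 0, w, 0), (c, 0, c2, c3), with w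
    positive, hor_triple determines c2, c3 and w from r, b and c: its third and
    fourth equations give c3 and c2, and the last one says that s = w ^+ 2 is a root
    of 3 s^2 + pivot_lin s - pivot_cst. *)
Definition pivot_lin r b c : R := 3 * sqnormc b - 5 * r ^+ 2 - sqnormc c.
Definition pivot_cst r b c : R := sqnormc (2 * r%:C * b - b^* * c) + 9 * r ^+ 2 * sqnormc c.
Definition pivot_root r b c : R :=
  (Num.sqrt (pivot_lin r b c ^+ 2 + 12 * pivot_cst r b c) - pivot_lin r b c) / 6.
Definition pivot r b c : R := Num.sqrt (pivot_root r b c).

Definition std_a r : 'cV[C]_4 := vec4 r%:C 0 0 0.
Definition std_b b (w : R) : 'cV[C]_4 := vec4 b 0 w%:C 0.
Definition std_c r b c (w : R) : 'cV[C]_4 :=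
  vec4 c 0 ((2 * r%:C * b - b^* * c) / w%:C) (- (3 * r%:C * c^*) / w%:C).

Definition std_curve r b c := real_curve (std_a r) (std_b b (pivot r b c)) (std_c r b c (pivot r b c)).

(** The parameters of the standard curves in use. If r = 0, the curve vanishes at 0
    and at infinity; then b and c are orthogonal over H, and Sp(2) makes the
    parameter b zero. *)
Definition admissible r b c := 0 < r \/ [/\ r = 0, b = 0 & c != 0].

Lemma pivot_cst_ge0 r b c : 0 <= pivot_cst r b c.
Proof.
apply: addr_ge0; first exact: sqnormc_ge0.
by apply: mulr_ge0; [rewrite mulr_ge0 ?sqr_ge0|exact: sqnormc_ge0].
Qed.

Lemma sqnormc_gt0 (z : C) : z != 0 -> 0 < sqnormc z.
Proof. by move=> z0; rewrite lt_neqAle eq_sym sqnormc_eq0 z0 sqnormc_ge0. Qed.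

Lemma sqnormc0 : sqnormc (0 : C) = 0.
Proof. by apply/eqP; rewrite sqnormc_eq0. Qed.

Lemma pivot_root_gt0 r b c : admissible r b c -> 0 < pivot_root r b c.
Proof.
move=> h; rewrite /pivot_root divr_gt0// subr_gt0.
have Q0 := pivot_cst_ge0 r b c.
have [Bn|Bp] := ltrP (pivot_lin r b c) 0; first exact: lt_le_trans Bn (sqrtr_ge0 _).
suff Qp : 0 < pivot_cst r b c.
  by rewrite -{1}(ger0_norm Bp) -sqrtr_sqr ltr_sqrt; nra.
rewrite lt_neqAle Q0 andbT eq_sym; apply/eqP => Qz.
have : pivot_lin r b c < 0; last by rewrite ltNge Bp.
case: h => [r0|[r0 b0 c0]]; last first.
  by rewrite /pivot_lin r0 b0 sqnormc0; have := sqnormc_gt0 c0; lra.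
have r2 : 0 < r ^+ 2 by rewrite exprn_gt0.
have s1 := sqnormc_ge0 (2 * r%:C * b - b^* * c); have s2 := sqnormc_ge0 c.
have c0 : c = 0.
  apply/eqP; rewrite -sqnormc_eq0; apply/eqP; move: Qz; rewrite /pivot_cst.
    by move: (sqnormc _) s1 (sqnormc c) s2 (r ^+ 2) r2 => x x0 y y0 z z0; nra.
move: Qz; rewrite /pivot_cst c0 mulr0 subr0 sqnormc0 mulr0 addr0 => /eqP.
rewrite sqnormc_eq0 !mulf_eq0 pnatr_eq0/= (inj_eq (@complexI R)) gt_eqF//= => /eqP ->.
by rewrite /pivot_lin sqnormc0; lra.
Qed.

Lemma pivot_rootP r b c : 3 * pivot_root r b c ^+ 2 + pivot_lin r b c * pivot_root r b c = pivot_cst r b c.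
Proof.
have Q0 := pivot_cst_ge0 r b c; rewrite /pivot_root.
have [s [e ->]] : exists s, s ^+ 2 = pivot_lin r b c ^+ 2 + 12 * pivot_cst r b c /\
    Num.sqrt (pivot_lin r b c ^+ 2 + 12 * pivot_cst r b c) = s.
  by eexists; split; [|reflexivity]; rewrite sqr_sqrtr// addr_ge0 ?sqr_ge0// mulr_ge0.
move: (pivot_lin _ _ _) (pivot_cst _ _ _) e => B Q e.
have -> : Q = (s ^+ 2 - B ^+ 2) / 12 by rewrite e; field.
by field.
Qed.

Lemma pivot_root_unique r b c s : 0 < s -> 3 * s ^+ 2 + pivot_lin r b c * s = pivot_cst r b c ->
  pivot_root r b c = s.
Proof.
move=> s0 e; have Q0 := pivot_cst_ge0 r b c.
have p : 0 <= 6 * s + pivot_lin r b c.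
  have : 0 <= 3 * s + pivot_lin r b c by rewrite -(pmulr_rge0 _ s0); nra.
  by lra.
rewrite /pivot_root.
have -> : pivot_lin r b c ^+ 2 + 12 * pivot_cst r b c = (6 * s + pivot_lin r b c) ^+ 2 by rewrite -e; ring.
by rewrite sqrtr_sqr ger0_norm//; field.
Qed.

Lemma pivot_neq0 r b c : admissible r b c -> (pivot r b c)%:C != 0.
Proof.
by move=> h; rewrite (inj_eq (@complexI R)) sqrtr_eq0 -ltNge pivot_root_gt0.
Qed.

Lemma pivot_linE r b c : (pivot_lin r b c)%:C = 3 * (b * b^*) - 5 * r%:C ^+ 2 - c * c^*.
Proof. by rewrite -!sqnormcE /pivot_lin; move: (sqnormc _) (sqnormc _) => x y; ring. Qed.

Lemma pivot_cstE r b c : (pivot_cst r b c)%:C =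
  (2 * r%:C * b - b^* * c) * (2 * r%:C * b^* - b * c^*) + 9 * r%:C ^+ 2 * (c * c^*).
Proof.
have -> : 2 * r%:C * b^* - b * c^* = (2 * r%:C * b - b^* * c)^*.
  by rewrite rmorphB !rmorphM rmorph_nat /= conjCK conj_real.
by rewrite -!sqnormcE /pivot_cst; move: (sqnormc _) (sqnormc _) => x y; ring.
Qed.

Lemma std_hor_triple r b c w : w != 0 -> 3 * (w ^+ 2) ^+ 2 + pivot_lin r b c * w ^+ 2 = pivot_cst r b c ->
  hor_triple (std_a r) (std_b b w) (std_c r b c w).
Proof.
move=> w0 e.
have w0' : w%:C != 0 :> C by rewrite (inj_eq (@complexI R)).
have e' : 5 * (r%:C * r%:C) + c * c^* = 3 * (b * b^* + w%:C * w%:C) -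
   ((2 * r%:C * b - b^* * c) * (2 * r%:C * b^* - b * c^*) + 9 * r%:C ^+ 2 * (c * c^*)) / w%:C ^+ 2.
  have : (pivot_cst r b c)%:C = 3 * (w%:C ^+ 2) ^+ 2 + (pivot_lin r b c)%:C * w%:C ^+ 2.
    by rewrite -e; ring.
  by rewrite -pivot_cstE pivot_linE => ->; field.
split; rewrite /omega ?hdotE !coordE ?conjC0 ?conj_real.
- by ring.
- by ring.
- by rewrite !mul0r; field.
- rewrite !mul0r !(rmorphM, rmorphD, rmorphN, fmorphV) /= ?rmorph_nat ?conjCK ?conj_real.
  by field.
- rewrite !mul0r !(rmorphM, rmorphD, rmorphN, fmorphV) /= ?rmorph_nat ?conjCK ?conj_real.
  rewrite !addr0; transitivity (5 * (r%:C * r%:C) + c * c^* +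
   ((2 * r%:C * b - b^* * c) * (2 * r%:C * b^* - b * c^*) + 9 * r%:C ^+ 2 * (c * c^*)) / w%:C ^+ 2).
    by field.
  by rewrite e'; ring.
Qed.

Lemma pivot_gt0 r b c : admissible r b c -> 0 < pivot r b c.
Proof. by move=> h; rewrite sqrtr_gt0 pivot_root_gt0. Qed.

Lemma std_curve_hor r b c z : admissible r b c ->
  omega (velocity (std_curve r b c) (Some z)) (curve (std_curve r b c) (Some z)) = 0.
Proof.
move=> h; move: z; apply/hor_tripleP/std_hor_triple; first by rewrite gt_eqF// pivot_gt0.
have -> : pivot r b c ^+ 2 = pivot_root r b c by rewrite sqr_sqrtr// ltW// pivot_root_gt0.
exact: pivot_rootP.
Qed.

(** The equations of hor_triple are solved for the other entries; w = 0 would make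
    the left-hand side of the last one positive and its right-hand side zero. *)
Lemma echelon_std_curve r w (b0 b1 c0 c1 c2 c3 : C) : 0 < r -> 0 <= w ->
  hor_triple (std_a r) (vec4 b0 b1 w%:C 0) (vec4 c0 c1 c2 c3) ->
  real_curve (std_a r) (vec4 b0 b1 w%:C 0) (vec4 c0 c1 c2 c3) = std_curve r b0 c0.
Proof.
move=> r0 w0 [].
rewrite /omega ?hdotE !coordE ?conjC0 ?conj_real !(mul0r, mulr0, addr0, subr0, add0r).
have rn : r%:C != 0 :> C by rewrite (inj_eq (@complexI R)) gt_eqF.
move=> /eqP; rewrite mulf_eq0 (negbTE rn) => /eqP b10.
move=> /eqP; rewrite mulf_eq0 (negbTE rn) => /eqP c10.
rewrite b10 c10 ?conjC0 => e3 e4 e5.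
have {}e3 : w%:C * c3 = - (3 * r%:C * c0^*).
  by apply/eqP; rewrite -addr_eq0 -[X in _ == X]e3; apply/eqP; ring.
have {}e4 : w%:C * c2^* = 2 * r%:C * b0^* - b0 * c0^*.
  by apply/eqP; rewrite eq_sym subr_eq -mulrA -e4; apply/eqP; ring.
have {}e5 : 5 * (r%:C * r%:C) + c0 * c0^* + c2 * c2^* + c3 * c3^* =
    3 * (b0 * b0^* + w%:C * w%:C) by move: e5; rewrite !(mulr0, addr0) !addrA.
have e3' : w%:C * c3^* = - (3 * r%:C * c0).
  have := congr1 Num.conj e3.
  by rewrite !(rmorphM, rmorphN) /= conjCK !conj_real rmorph_nat.
have e4' : w%:C * c2 = 2 * r%:C * b0 - b0^* * c0.
  have := congr1 Num.conj e4.
  by rewrite rmorphB !rmorphM /= !conjCK !conj_real rmorph_nat.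
have [wz|wn] := eqVneq w 0.
  move: e3 e4; rewrite wz rmorph0 !mul0r => /esym/eqP.
  rewrite oppr_eq0 !mulf_eq0 pnatr_eq0 (negbTE rn) /= conjC_eq0 => /eqP c00.
  rewrite c00 conjC0 mulr0 subr0 => /esym/eqP.
  rewrite !mulf_eq0 pnatr_eq0 (negbTE rn) /= conjC_eq0 => /eqP b00.
  move: e5; rewrite c00 b00 wz !(rmorph0, conjC0, mul0r, mulr0, addr0, add0r) -!sqnormcE => E.
  have {}E : 5 * (r * r) + sqnormc c2 + sqnormc c3 = 0.
    by apply: (@complexI R); rewrite rmorph0 -E; move: (sqnormc _) (sqnormc _) => x y; ring.
  exfalso; have := sqnormc_ge0 c2; have := sqnormc_ge0 c3; nra.
have {}w0 : 0 < w by rewrite lt_neqAle eq_sym wn.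
have wn' : w%:C != 0 :> C by rewrite (inj_eq (@complexI R)).
have c3E : c3 = - (3 * r%:C * c0^*) / w%:C by rewrite -e3 mulrC mulKf.
have c2E : c2 = (2 * r%:C * b0 - b0^* * c0) / w%:C by rewrite -e4' mulrC mulKf.
have sE : pivot_root r b0 c0 = w ^+ 2.
  apply: pivot_root_unique; first by rewrite exprn_gt0.
  apply: (@complexI R); rewrite pivot_cstE -e4' -e4.
  have -> : 9 * r%:C ^+ 2 * (c0 * c0^*) = (w%:C * c3) * (w%:C * c3^*) by rewrite e3 e3'; ring.
  have -> : (3 * (w ^+ 2) ^+ 2 + pivot_lin r b0 c0 * w ^+ 2)%:C =
    3 * (w%:C ^+ 2) ^+ 2 + (pivot_lin r b0 c0)%:C * w%:C ^+ 2 by ring.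
  rewrite pivot_linE; have -> : 3 * (b0 * b0^*) =
    5 * (r%:C * r%:C) + c0 * c0^* + c2 * c2^* + c3 * c3^* - 3 * (w%:C * w%:C) by rewrite e5; ring.
  by ring.
rewrite /std_curve /pivot sE sqrtr_sqr gtr0_norm//.
by rewrite /std_c -c2E -c3E.
Qed.

(** Exchange of roles in echelon_std_curve for a curve that vanishes at 0: there c
    is normalized in place of a. *)
Lemma echelon0_std_curve w (b0 b1 : C) r : 0 <= w -> 0 < r ->
  hor_triple (std_a 0) (vec4 b0 b1 w%:C 0) (vec4 r%:C 0 0 0) ->
  real_curve (std_a 0) (vec4 b0 b1 w%:C 0) (vec4 r%:C 0 0 0) = std_curve 0 0 r%:C.
Proof.
move=> w0 r0 [].
rewrite /omega ?hdotE !coordE ?conjC0 ?rmorph0 ?conj_real !(mul0r, mulr0, addr0, subr0, add0r, sub0r).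
have rn : r%:C != 0 :> C by rewrite (inj_eq (@complexI R)) gt_eqF.
move=> _ _ /eqP; rewrite oppr_eq0 mulf_eq0 (negbTE rn) orbF => /eqP b10.
move=> /eqP; rewrite mulf_eq0 (negbTE rn) orbF => /eqP b00.
rewrite b10 b00 => e5; have {}e5 : r ^+ 2 = 3 * w ^+ 2.
  apply: (@complexI R); move: e5; rewrite ?conjC0 => e5.
  have -> : (r ^+ 2)%:C = r%:C * r%:C by ring.
  by apply: etrans (etrans _ e5) _; ring.
have sE : pivot_root 0 0 r%:C = w ^+ 2.
  have nr : sqnormc r%:C = r ^+ 2 by rewrite /sqnormc /= expr0n addr0 sqrtr_sqr real_normK ?num_real.
  have BE : pivot_lin 0 0 r%:C = - r ^+ 2 by rewrite /pivot_lin sqnormc0 nr; ring.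
  have QE : pivot_cst 0 0 r%:C = 0.
    have z0 : 2 * (0 : R)%:C * 0 - 0^* * r%:C = 0 :> C by rewrite conjC0; ring.
    by rewrite /pivot_cst z0 sqnormc0; ring.
  rewrite /pivot_root BE QE mulr0 addr0 sqrrN sqrtr_sqr ger0_norm ?sqr_ge0//.
  by rewrite e5; field.
rewrite /std_curve /pivot sE sqrtr_sqr ger0_norm//.
by rewrite /std_c !rmorph0 !(mulr0, mul0r, conjC0, subr0, oppr0).
Qed.

End NormalForm.

(** * Reduction to a standard curve *)

Section Reduction.
Context {R : realType}.
Local Notation C := R[i].
Implicit Types (A : 'M[C]_(4, 6)) (v : 'cV[C]_4).

Lemma sigmaK A : sigma (sigma A) = A.
Proof.
apply: col_inj; apply: forall6; rewrite col_sigma rev_inord// col_sigma rev_inord// !inordK//= jvZ jvK ?exprS ?expr0 ?(mulr1, mulN1r, opprK) ?(rmorphN, rmorph1) ?scaleN1r ?scale1r ?opprK//.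
Qed.

(** If sigma A = mu A, then |mu| = 1 because sigma is an involution (the degree
    being odd). Then 1 + mu is a solution, except for mu = -1, when 'i is one. *)
Lemma limit_curve_fixed A : A != 0 -> limit_curve A ->
  exists2 c, c != 0 & sigma (c *: A) = c *: A.
Proof.
move=> A0 [hA _].
have [i [k Aik]] : exists i k, A i k != 0.
  apply/not_existsP => h; move/eqP: A0; apply; apply/matrixP => i k; rewrite mxE.
  by apply/eqP; apply: contraT => Aik; case: (h i); exists k.
pose mu := sigma A i k / A i k.
have sA : sigma A = mu *: A.
  apply/matrixP => j l; rewrite [RHS]mxE; apply: (mulIf Aik).
  by rewrite hA /mu mulrAC mulfVK// mulrC.
have mu1 : mu^* * mu = 1.
  have /matrixP/(_ i k) := sigmaK A; rewrite {1}sA sigmaZ sA scalerA [LHS]mxE.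
  by move=> e; apply: (mulIf Aik); rewrite e mul1r.
have [e|mun1] := eqVneq (1 + mu) 0.
  have muE : mu = -1 by apply/eqP; rewrite -addr_eq0 addrC e.
  exists 'i%C; first by rewrite eq_complex /= oner_eq0 andbF.
  have iC : ('i%C : C)^* = - 'i%C by rewrite -[LHS]/(conjc _) /=; simpc.
  by rewrite sigmaZ sA muE scalerA iC mulrNN mulr1.
exists (1 + mu) => //; by rewrite sigmaZ sA scalerA rmorphD rmorph1 mulrDl mul1r mu1 addrC.
Qed.

Lemma vec4_eta v : v = vec4 (coord v 0) (coord v 1) (coord v 2) (coord v 3).
Proof. by apply: coordP; rewrite coord_vec4. Qed.

Lemma symplectic_pathP M M' : @symplectic_path R M M' ->
  [/\ symplectic M, symplectic M', M *m M' = 1%:M & M' *m M = 1%:M].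
Proof. by move=> [m [n [_ _ h _ [<- <-]]]]; exact: h. Qed.

(** Move a, or c if a = 0, to the positive half-line of the first coordinate axis;
    gen2 keeps it there and makes the third coordinate of b real and nonnegative and the
    fourth one zero. *)
Lemma std_curve_exists (a b c : 'cV[C]_4) : hor_triple a b c -> real_curve a b c != 0 ->
  exists M M' r b' c', [/\ symplectic_path M M', admissible r b' c' &
    real_curve a b c = M' *m std_curve r b' c'].
Proof.
move=> habc nz.
have red M M' r b' c' : symplectic_path M M' -> admissible r b' c' ->
    real_curve (M *m a) (M *m b) (M *m c) = std_curve r b' c' ->
    exists M M' r b' c', [/\ symplectic_path M M', admissible r b' c' &
    real_curve a b c = M' *m std_curve r b' c'].
  move=> sM ad e; exists M, M', r, b', c'; split => //.
  have [sp1 _ _ MM] := symplectic_pathP sM.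
  by rewrite -e -symplectic_real_curve// mulmxA MM mul1mx.
have [a0|a0] := eqVneq a 0.
  have [M1 [M1' [s1 [r r0 Mc]]]] := symplectic_path_normalize c.
  have [x [y [w w0 [u e f]]]] := rotate2 (coord (M1 *m b) 2) (coord (M1 *m b) 3).
  have [M2' s2] := symplectic_path_gen2 u.
  have s := symplectic_pathM s2 s1; have [ss _ _ inv] := symplectic_pathP s.
  set M := _ *m M1 in s ss inv.
  have Ma : M *m a = std_a 0 by rewrite a0 mulmx0 /std_a rmorph0; apply: coordP; rewrite !coordE.
  have Mc' : M *m c = vec4 r%:C 0 0 0.
    by rewrite /M -mulmxA Mc gen2E !coordE !mulr0 subr0 addr0.
  have Mb : exists b0 b1, M *m b = vec4 b0 b1 w%:C 0.
    by do 2!eexists; rewrite /M -mulmxA gen2E e f.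
  have [b0 [b1 {}Mb]] := Mb.
  have := habc; rewrite -(symplectic_hor_triple _ _ _ ss) Ma Mb Mc' => hh.
  have {}r0 : 0 < r.
    rewrite lt_neqAle r0 andbT eq_sym; apply/eqP => rz; move/eqP: nz; apply.
    have v0 : vec4 0 0 0 0 = 0 :> 'cV[C]_4 by apply: coordP; rewrite !coordE.
    have c0 : c = 0 by rewrite -[c]mul1mx -inv -mulmxA Mc' rz rmorph0 v0 mulmx0.
    have [_ _ _ _ /eqP] := habc; rewrite a0 c0 !hdotE !coord0 !mul0r !addr0 mulr0.
    rewrite -hdotE eq_sym mulf_eq0 pnatr_eq0 /= -norm2E (inj_eq (@complexI R) _ 0) norm2_eq0 => /eqP ->.
    by apply: col_inj; apply: forall6; rewrite col_real_curve inordK//= ?jv0 ?oppr0; apply/matrixP => i j; rewrite !mxE.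
  apply: (red M _ 0 0 r%:C s); first by right; rewrite (inj_eq (@complexI R)) gt_eqF.
  rewrite Ma Mb Mc'; exact: echelon0_std_curve.
have [M1 [M1' [s1 [r r0 Ma1]]]] := symplectic_path_normalize a.
have [x [y [w w0 [u e f]]]] := rotate2 (coord (M1 *m b) 2) (coord (M1 *m b) 3).
have [M2' s2] := symplectic_path_gen2 u.
have s := symplectic_pathM s2 s1; have [ss _ _ inv] := symplectic_pathP s.
set M := _ *m M1 in s ss inv.
have Ma : M *m a = std_a r.
  by rewrite /M -mulmxA Ma1 gen2E !coordE !mulr0 subr0 addr0.
have Mb : exists b0 b1, M *m b = vec4 b0 b1 w%:C 0.
  by do 2!eexists; rewrite /M -mulmxA gen2E e f.
have [b0 [b1 {}Mb]] := Mb.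
have {}r0 : 0 < r.
  rewrite lt_neqAle r0 andbT eq_sym; apply: contraNneq a0 => rz.
  have [_ _ _ inv1] := symplectic_pathP s1.
  rewrite -[a]mul1mx -inv1 -mulmxA Ma1 rz rmorph0.
  have -> : vec4 0 0 0 0 = 0 :> 'cV[C]_4 by apply: coordP; rewrite !coordE.
  by rewrite mulmx0.
have := habc; rewrite -(symplectic_hor_triple _ _ _ ss) Ma Mb [M *m c]vec4_eta => hh.
apply: (red M _ r b0 (coord (M *m c) 0) s); first by left.
by rewrite Ma Mb [M *m c in LHS]vec4_eta; exact: echelon_std_curve.
Qed.

End Reduction.

(** * Standard curves without common zeros *)

Section Good.
Context {R : realType}.
Local Notation C := R[i].

Lemma nonvanishing_holomorphic d (A : 'M[C]_(4, d.+1)) :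
  (forall p, curve A p != 0) -> holomorphic_curve A.
Proof.
move=> nz; split=> [z|].
  apply/not_existsP => h; move/eqP: (nz (Some z)); apply; apply/matrixP => i j.
  by rewrite !mxE; apply/rootP; apply: contraT => hi; case: (h i).
apply/eqP; rewrite eqn_leq; apply/andP; split.
  by apply/bigmax_leqP => i _; exact: size_poly.
have [i Ai] : exists i, A i ord_max != 0.
  apply/not_existsP => h; move/eqP: (nz None); apply; apply/matrixP => i j.
  by rewrite curve_inf !mxE; apply/eqP; apply: contraT => hi; case: (h i).
apply: leq_trans (leq_bigmax i); rewrite ltnNge; apply: contraNN Ai => sz.
by rewrite -coef_component nth_default.
Qed.

Lemma linearly_full_cols d (A : 'M[C]_(4, d.+1)) :
  (forall a : 'rV[C]_4, (forall k, a *m col k A = 0) -> a = 0) -> linearly_full A.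
Proof.
move=> h a /eqP a0 hp; apply: a0; apply: h => k.
have h0 : \sum_i a 0 i *: component A i = 0.
  apply: poly_eq0 => z; have /matrixP/(_ 0 0) := hp (Some z); rewrite !mxE => E.
  by rewrite horner_sum -[RHS]E; apply: eq_bigr => i _; rewrite hornerZ mxE.
apply/matrixP => i j; rewrite !ord1 !mxE -[RHS](coef0 _ k) -h0 coef_sum.
by apply: eq_bigr => l _; rewrite coefZ coef_component mxE.
Qed.

Lemma curve_mulmx d (M : 'M[C]_4) (A : 'M[C]_(4, d.+1)) p : curve (M *m A) p = M *m curve A p.
Proof.
case: p => [z|]; last by rewrite !curve_inf !colE mulmxA.
rewrite !curveE mulmx_sumr; apply: eq_bigr => k _.
by rewrite -scalemxAr !colE mulmxA.
Qed.

Lemma velocity_mulmx d (M : 'M[C]_4) (A : 'M[C]_(4, d.+1)) z :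
  velocity (M *m A) (Some z) = M *m velocity A (Some z).
Proof.
rewrite !velocityE mulmx_sumr; apply: eq_bigr => k _.
by rewrite -scalemxAr !colE mulmxA.
Qed.

(** The first two coordinates are r + b z + c z^2 and z^3 (c^* - b^* z + r z^2).
    Eliminating b from their common zeros gives c z = - r z^*, hence |c| = r. *)
Lemma std_curve_neq0 (r : R) (b c : C) p : 0 < r -> sqnormc c != r ^+ 2 ->
  curve (std_curve r b c) p != 0.
Proof.
move=> r0 cr.
have rn : r%:C != 0 :> C by rewrite (inj_eq (@complexI R)) gt_eqF.
case: p => [z|]; last first.
  rewrite curve_inf (_ : ord_max = inord 5) ?col_real_curve; last by apply/val_inj; rewrite /= inordK.
  rewrite inordK//= jv_eq0; apply: contra rn => /eqP/(congr1 (coord^~ 0)).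
  by rewrite /std_a !coordE => ->.
apply/eqP => h; move/eqP: cr; apply.
have h0 : r%:C + b * z + c * z ^+ 2 = 0.
  have := congr1 (coord^~ 0) h; rewrite curve_real_curve !coordE conjC0.
  by move=> e; rewrite -[RHS]e; ring.
have h1 : z ^+ 3 * (c^* - b^* * z + r%:C * z ^+ 2) = 0.
  have := congr1 (coord^~ 1) h; rewrite curve_real_curve !coordE conj_real.
  by move=> e; rewrite -[RHS]e; ring.
have z0 : z != 0.
  by apply: contraNneq rn => z0; move: h0; rewrite z0 expr0n /= !mulr0 !addr0 => ->.
move: h1 => /eqP; rewrite mulf_eq0 expf_eq0 (negbTE z0) /= => /eqP h1.
have h2 : c - b * z^* + r%:C * z^* ^+ 2 = 0.
  have := congr1 Num.conj h1.
  by rewrite rmorph0 rmorphD rmorphB !rmorphM /= !conjCK conj_real.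
(* The combination of h0 and h2 that eliminates b. *)
have : (1 + z * z^*) * (r%:C * z^* + c * z) = 0.
  have -> : (1 + z * z^*) * (r%:C * z^* + c * z) =
    (r%:C + b * z + c * z ^+ 2) * z^* + (c - b * z^* + r%:C * z^* ^+ 2) * z by ring.
  by rewrite h0 h2; ring.
have nz : 1 + z * z^* != 0.
  rewrite -sqnormcE -(rmorph1 (real_complex R)) -rmorphD (inj_eq (@complexI R) _ 0).
  by rewrite gt_eqF// ltr_wpDr ?sqnormc_ge0.
move=> /eqP; rewrite mulf_eq0 (negbTE nz) /= addrC addr_eq0 => /eqP E.
have : (c * z) * (c * z)^* = (r%:C ^+ 2) * (z * z^*).
  by rewrite E rmorphN rmorphM /= conj_real conjCK; ring.
have zz : (sqnormc z)%:C != 0 :> C by rewrite (inj_eq (@complexI R) _ 0) sqnormc_eq0.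
rewrite rmorphM mulrACA /= -!sqnormcE => /(mulIf zz) e; apply: (@complexI R).
by rewrite e -rmorphXn.
Qed.

(** The columns 0, 5, 1 and 4 of a standard curve form a triangular system. *)
Lemma std_curve_full (r : R) (b c : C) (a : 'rV[C]_4) : 0 < r ->
  (forall k, a *m col k (std_curve r b c) = 0) -> a = 0.
Proof.
move=> r0 h.
have ad : admissible r b c by left.
have rn : r%:C != 0 :> C by rewrite (inj_eq (@complexI R)) gt_eqF.
have wn := pivot_neq0 ad.
have mE (v : 'cV[C]_4) : a *m v = 0 -> a 0 (inord 0) * coord v 0 + a 0 (inord 1) * coord v 1 +
   a 0 (inord 2) * coord v 2 + a 0 (inord 3) * coord v 3 = 0.
  by move=> /matrixP/(_ 0 0); rewrite !mxE sum4.
have e0 := mE _ (h (inord 0)); have e1 := mE _ (h (inord 1)).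
have e4 := mE _ (h (inord 4)); have e5 := mE _ (h (inord 5)).
rewrite col_real_curve inordK//= !coordE !(mulr0, addr0) in e0.
rewrite col_real_curve inordK//= !coord_jv !coordE !(conjC0, conj_real, oppr0, mulr0, addr0, add0r) in e5.
have a0 : a 0 (inord 0) = 0 by apply/eqP; move/eqP: e0; rewrite mulf_eq0 (negbTE rn) orbF.
have a1 : a 0 (inord 1) = 0 by apply/eqP; move/eqP: e5; rewrite mulf_eq0 (negbTE rn) orbF.
rewrite col_real_curve inordK//= !coordE a0 a1 !(mul0r, mulr0, addr0, add0r) in e1.
rewrite col_real_curve inordK//= !coordE a0 a1 !(conjC0, conj_real, oppr0, mul0r, mulr0, addr0, add0r) in e4.
have a2 : a 0 (inord 2) = 0 by apply/eqP; move/eqP: e1; rewrite mulf_eq0 (negbTE wn) orbF.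
have a3 : a 0 (inord 3) = 0.
  by apply/eqP; move/eqP: e4; rewrite mulrN oppr_eq0 mulf_eq0 (negbTE wn) orbF.
apply/matrixP => i j; rewrite ord1 [RHS]mxE; move: j; exact: forall4.
Qed.

Lemma std_curve_AHHol (M M' : 'M[C]_4) r b c :
  symplectic M -> M' *m M = 1%:M -> 0 < r -> sqnormc c != r ^+ 2 ->
  [/\ holomorphic_curve (M *m std_curve r b c), linearly_full (M *m std_curve r b c),
      horizontal (M *m std_curve r b c) & antipodally_invariant (M *m std_curve r b c)].
Proof.
move=> sM inv r0 cr.
have nz p : curve (M *m std_curve r b c) p != 0.
  rewrite curve_mulmx; apply: contra (std_curve_neq0 b p r0 cr) => /eqP e.
  by rewrite -[curve _ _]mul1mx -inv -mulmxA e mulmx0.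
split.
- exact: nonvanishing_holomorphic.
- apply: linearly_full_cols => a h.
  have : a *m M = 0.
    by apply: (@std_curve_full r b c) => // k; rewrite -(h k) !colE !mulmxA.
  by move=> e; rewrite -[a]mulmx1 -(mulmx1C inv) mulmxA e mul0mx.
- apply: omega_horizontal => // -[z|].
    rewrite velocity_mulmx curve_mulmx symplectic_omega// std_curve_hor//; by left.
  have -> : velocity (M *m std_curve r b c) None = M *m (- jv (std_b b (pivot r b c))).
    by rewrite symplectic_real_curve// velocity_real_curve_inf mulmxN sM.1.
  rewrite curve_mulmx symplectic_omega// curve_inf.
  have -> : ord_max = inord 5 :> 'I_6 by apply/val_inj; rewrite /= inordK.
  rewrite col_real_curve inordK//= /omega !coordE !conjC0; ring.
- apply: sigma_antipodal => //; rewrite symplectic_real_curve//; exact: sigma_real_curve.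
Qed.

End Good.

(** * Paths of curves *)

Section Path.
Context {R : realType}.
Local Notation C := R[i].

Lemma continuousC_Re (T : topologicalType) (f : T -> C) : continuousC f ->
  continuous (fun t => complex.Re (f t)).
Proof.
move=> hf x; apply: (@continuous_cvg _ C^o R (nbhs x) _ f (@complex.Re R) (f x)); last exact: hf.
move=> A /= /nbhs_ballP[e e0 he]; apply/nbhs_ballP; exists e%:C.
  by rewrite /= (ltcR 0).
move=> y /= ye; apply: he; move: ye; rewrite /ball /= -(ltcR _ e).
apply: le_lt_trans; rewrite -raddfB /=.
by apply: le_trans (normc_ge_Re _) _.
Qed.

Lemma continuous_sqnormc (T : topologicalType) (f : T -> C) : continuousC f ->
  continuous (fun t => sqnormc (f t)).
Proof.
move=> hf; rewrite (_ : (fun t => sqnormc (f t)) = fun t => complex.Re (f t * (f t)^*)).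
  exact: (continuousC_Re (continuousCM hf (continuousC_conj hf))).
by apply/funext => t; rewrite -sqnormcE.
Qed.

Lemma continuous_mx (T : topologicalType) m n (f : T -> 'M[C]_(m, n)) :
  (forall i j, continuousC (fun t => f t i j)) -> continuous (f : T -> 'M[C^o]_(m, n)).
Proof.
move=> h t A [P hP sPA]; apply: filterS sPA _; rewrite nbhs_filterE.
apply: filter_forall => i; apply: filter_forall => j; exact: h (hP i j).
Qed.

Lemma continuous_proj d (f : R -> 'M[C^o]_(4, d.+1)) (f0 : forall t, f t \in @punctured R d) :
  continuous f ->
  continuous (fun t => proj_point (exist (fun A => A \in @punctured R d) (f t) (f0 t) : @punctured R d)).
Proof.
move=> cf t.
apply: (@continuous_comp _ _ _ (fun t => exist (fun A => A \in @punctured R d) (f t) (f0 t) : @punctured R d) (@proj_point R d)).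
  move: t; apply: (@continuous_comp_initial _ _ _ (set_val : @punctured R d -> _)).
  exact: cf.
exact: pi_continuous.
Qed.

(** The projection of the line onto the unit interval. It makes paths that are
    meaningful for parameters in the unit interval everywhere defined. *)
Definition clamp (t : R) : R := (`|t| - `|t - 1| + 1) / 2.

Lemma continuous_clamp : continuous clamp.
Proof.
move=> t; apply: cvgM; last exact: cvg_cst.
apply: cvgD; last exact: cvg_cst.
apply: cvgB; apply: cvg_norm; first exact: cvg_id.
by apply: cvgB; [exact: cvg_id|exact: cvg_cst].
Qed.

Lemma clamp_id t : 0 <= t <= 1 -> clamp t = t.
Proof.
move=> /andP[t0 t1]; rewrite /clamp ger0_norm// ler0_norm ?subr_le0//.
by field.
Qed.

Lemma clamp_itv t : 0 <= clamp t <= 1.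
Proof.
rewrite /clamp; case: (ger0P t) => t0; case: (ger0P (t - 1)) => t1;
  by apply/andP; split; lra.
Qed.

Lemma continuousC_std_curve (r : R -> R) (b c : R -> C) : continuous r -> continuousC b -> continuousC c ->
  (forall t, admissible (r t) (b t) (c t)) ->
  forall i j, continuousC (fun t => std_curve (r t) (b t) (c t) i j).
Proof.
move=> cr cb cc ad.
have cr' := continuousC_real cr.
have k0 (a : C) : continuousC (fun _ : R => a) by exact: continuousC_cst.
have cq : continuousC (fun t => 2 * (r t)%:C * b t - (b t)^* * c t).
  apply: continuousCB; apply: continuousCM; [|exact: cb|exact: continuousC_conj|exact: cc].
  by apply: continuousCM; [exact: k0|exact: cr'].
have cB : continuous (fun t => pivot_lin (r t) (b t) (c t)).
  move=> t; rewrite /pivot_lin; apply: cvgB; last exact: (continuous_sqnormc cc).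
  apply: cvgB; apply: cvgM; [exact: cvg_cst|exact: (continuous_sqnormc cb)|exact: cvg_cst|].
  by apply: cvgM; exact: cr.
have cQ : continuous (fun t => pivot_cst (r t) (b t) (c t)).
  move=> t; rewrite /pivot_cst; apply: cvgD; first exact: (continuous_sqnormc cq).
  apply: cvgM; last exact: (continuous_sqnormc cc).
  by apply: cvgM; [exact: cvg_cst|apply: cvgM; exact: cr].
have cw : continuous (fun t => pivot (r t) (b t) (c t)).
  move=> t; rewrite /pivot; apply: continuous_cvg; first exact: sqrt_continuous.
  rewrite /pivot_root; apply: cvgM; last exact: cvg_cst.
  apply: cvgB; last exact: cB.
  apply: continuous_cvg; first exact: sqrt_continuous.
  apply: cvgD; first by apply: cvgM; exact: cB.
  by apply: cvgM; [exact: cvg_cst|exact: cQ].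
have cw' := continuousC_real cw.
have cv : continuousC (fun t => ((pivot (r t) (b t) (c t))%:C)^-1).
  by apply: (continuousCV cw') => t; exact: pivot_neq0.
have cA : forall j, continuousC (fun t => std_a (r t) j 0) := continuousC_vec4 cr' (k0 0) (k0 0) (k0 0).
have cBv : forall j, continuousC (fun t => std_b (b t) (pivot (r t) (b t) (c t)) j 0) :=
  continuousC_vec4 cb (k0 0) cw' (k0 0).
have cC : forall j, continuousC (fun t => std_c (r t) (b t) (c t) (pivot (r t) (b t) (c t)) j 0).
  exact: (continuousC_vec4 cc (k0 0) (continuousCM cq cv) (continuousCM (continuousCN (continuousCM (continuousCM (k0 3) cr') (continuousC_conj cc))) cv)).
have entryN (v : 'cV[C]_4) k : (- v) k 0 = - v k 0 by rewrite mxE.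
have cN j : continuousC (fun t => (- jv (std_b (b t) (pivot (r t) (b t) (c t)))) j 0).
  have h : continuousC (fun t => - jv (std_b (b t) (pivot (r t) (b t) (c t))) j 0).
    by apply: continuousCN; exact: (continuousC_jv cBv).
  exact: (eq_ind _ continuousC h _ (funext (fun t => esym (entryN _ j)))).
move=> i; apply: (@forall6 (fun j => continuousC (fun t => std_curve (r t) (b t) (c t) i j)));
  under eq_fun do rewrite mxE inordK//=.
- exact: cA.
- exact: cBv.
- exact: cC.
- exact: (continuousC_jv cC).
- exact: cN.
- exact: (continuousC_jv cA).
Qed.

(** Write a multiple of A as M' times a standard curve. Let M' move to the identity
    along a path in Sp(2) while the parameters of the standard curve move on a segment
    to (1, 0, 0). By std_curve_AHHol a point of this path with positive r belongs to
    AHHol_LF unless |c| = r, and this happens for at most one positive parameter t. *)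
Lemma limit_path (A : @punctured R 5) : limit_curve (val A) ->
  exists f : R -> proj_space R 5,
  [/\ continuous f, f 0 = proj_point A,
      exists2 e : R, 0 < e & forall t, 0 < t < e -> AHHol_LF R 5 (f t),
      forall t, exists2 B : @punctured R 5, limit_curve (val B) & f t = proj_point B &
      exists2 B : @punctured R 5, val B = std_curve 1 0 0 & f 1 = proj_point B].
Proof.
move=> hA.
have A0 : val A != 0 :> 'M[C]_(4, 6) by have := set_valP A.
have [c c0 sA] := limit_curve_fixed A0 hA.
have lA := limit_curveZ c hA.
have cA := sigma_fixed sA.
set a1 := col _ _ in cA; set a2 := col (inord 1) _ in cA; set a3 := col (inord 2) _ in cA.
have hor3 : hor_triple a1 a2 a3 by apply/hor_tripleP; rewrite -cA; exact: lA.2.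
have nz : real_curve a1 a2 a3 != 0 by rewrite -cA scaler_eq0 negb_or c0.
have [M [M' [r [b [c' [sM ad cE]]]]]] := std_curve_exists hor3 nz.
have [m [n [cm cn smn [m0 n0] [m1 n1]]]] := sM.
pose r' t := (1 - clamp t) * r + clamp t.
pose b' t := (1 - clamp t)%:C * b.
pose d' t := (1 - clamp t)%:C * c'.
have ad' t : admissible (r' t) (b' t) (d' t).
  have /andP[t0 t1] := clamp_itv t; rewrite /r' /b' /d'.
  case: ad => [r0|[r0 b0 d0]]; first by left; nra.
  have [e|tn] := eqVneq (clamp t) 0.
    by right; rewrite e r0 b0 subr0 rmorph1 !mulr0 mul1r addr0.
  by left; rewrite r0 mulr0 add0r lt_neqAle eq_sym tn.
pose G t : 'M[C^o]_(4, 6) := n (1 - t) *m std_curve (r' t) (b' t) (d' t).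
have nf0 (x : R) y z : admissible x y z -> std_curve x y z != 0.
  move=> h; have := pivot_neq0 h; apply: contraNneq => /matrixP/(_ (inord 2) (inord 1)).
  by rewrite mxE inordK//= -/(coord _ 2) /std_b coord_vec4 mxE => ->.
have G0 t : G t \in @punctured R 5.
  have [_ _ inv _] := smn (1 - t).
  rewrite inE /punctured /=; apply: contra (nf0 _ _ _ (ad' t)) => /eqP e.
  by rewrite -[std_curve _ _ _]mul1mx -inv -mulmxA [n _ *m _]e mulmx0.
have cc1 : continuous (fun t : R => 1 - clamp t).
  by move=> t; apply: cvgB; [exact: cvg_cst|exact: continuous_clamp].
have cG : continuous G.
  apply: continuous_mx; apply: continuousC_mulmx.
    move=> i j t; apply: (@continuous_comp _ _ _ (fun t : R => 1 - t) (fun t => n t i j : C^o)).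
      by apply: cvgB; [exact: cvg_cst|exact: cvg_id].
    exact: cn.
  apply: continuousC_std_curve => //.
  - move=> t; apply: cvgD; last exact: continuous_clamp.
    by apply: cvgM; [exact: cc1|exact: cvg_cst].
  - by rewrite /b'; apply: continuousCM; [exact: (continuousC_real cc1)|exact: continuousC_cst].
  - by rewrite /d'; apply: continuousCM; [exact: (continuousC_real cc1)|exact: continuousC_cst].
exists (fun t => proj_point (exist (fun A => A \in @punctured R 5) (G t) (G0 t) : @punctured R 5)).
split.
- exact: continuous_proj.
- have n1' : M' = n 1 by [].
  have G0E : G 0 = c *: val A.
    rewrite /G subr0 n1 cA cE /r' /b' /d' clamp_id ?lexx ?ler01//.
    by rewrite subr0 rmorph1 !mul1r addr0.
  apply/eqmodP; rewrite /= /proportional; apply/asboolP; exists c^-1; first by rewrite invr_eq0.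
  by rewrite /= G0E scalerA mulVf// scale1r.
- have r0 : 0 <= r by case: ad => [/ltW//|[-> _ _]].
  pose k := Num.sqrt (sqnormc c').
  have k0 : 0 <= k by exact: sqrtr_ge0.
  have k2 : sqnormc c' = k ^+ 2 by rewrite sqr_sqrtr// sqnormc_ge0.
  (* Along the path, c and r are (1 - t) c' and (1 - t) r + t. *)
  have [e [e0 e1 ek]] : exists e : R, [/\ 0 < e, e <= 1 &
      forall t, 0 < t < e -> (1 - t) * k != (1 - t) * r + t].
    have [kr|rk] := lerP k r.
      by exists 1; split => // t /andP[t0 t1]; apply/eqP; nra.
    have kr0 : 0 < 1 + (k - r) by lra.
    exists ((k - r) / (1 + (k - r))); split; first by rewrite divr_gt0// subr_gt0.
      by rewrite ler_pdivrMr//; lra.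
    by move=> t /andP[t0]; rewrite ltr_pdivlMr// => t1; apply/eqP; nra.
  exists e => // t te; have /andP[t0 t1] := te.
  have ct : clamp t = t by rewrite clamp_id// ltW//= (le_trans (ltW t1)).
  have rt : 0 < (1 - t) * r + t by nra.
  have [sn _ _ inv] := smn (1 - t); have [_ _ _ inv'] := smn (1 - t).
  exists (exist (fun A => A \in @punctured R 5) (G t) (G0 t) : @punctured R 5) => //.
  rewrite /= /G /r' /b' /d' ct; have [_ sn' inv2 _] := smn (1 - t).
  apply: (std_curve_AHHol _ sn' inv2 rt).
  have -> : sqnormc ((1 - t)%:C * c') = ((1 - t) * k) ^+ 2.
    apply: (@complexI R); rewrite sqnormcE rmorphM /= conj_real mulrACA -sqnormcE k2.
    by ring.
  rewrite eqrXn2// ?mulr_ge0// ?subr_ge0 ?(ltW rt)//; first exact: ek.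
  exact: le_trans (ltW t1) e1.
- move=> t; eexists; last reflexivity.
  rewrite /=; have [sn _ _ _] := smn (1 - t); have [_ snn _ _] := smn (1 - t).
  split.
    move=> i j k l; rewrite /G symplectic_real_curve// sigma_real_curve.
    by [].
  by move=> z; rewrite /G velocity_mulmx curve_mulmx symplectic_omega// std_curve_hor.
- eexists; last reflexivity.
  rewrite /= /G subrr n0 mul1mx /r' /b' /d' clamp_id ?ler01 ?lexx//.
  by rewrite subrr rmorph0 !mul0r add0r.
Qed.

(** A curve is the limit at 0 of the path of limit_path. *)
Lemma limit_closure (A : @punctured R 5) : limit_curve (val A) ->
  AHHol_LF_le R 5 (proj_point A).
Proof.
move=> /limit_path[f [cf f0 [e e0 he] _ _]].
rewrite /AHHol_LF_le -f0 => U nU.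
have /nbhs_ballP[d /= d0 dU] : nbhs (0 : R) (f @^-1` U) by exact: cf.
pose t := Num.min d e / 2.
have t0 : 0 < t by rewrite divr_gt0// lt_min d0.
have tm : t < Num.min d e by rewrite /t; have : 0 < Num.min d e; [rewrite lt_min d0|lra].
exists (f t); split; first by apply: he; rewrite t0 (lt_le_trans tm)// ge_min lexx orbT.
apply: dU; rewrite /ball /= sub0r normrN gtr0_norm// (lt_le_trans tm)//.
by rewrite ge_min lexx.
Qed.

Lemma join_paths (T : topologicalType) (f g : R -> T) : continuous f -> continuous g ->
  f 1 = g 1 -> exists2 h : R -> T, {within `[0, 1], continuous h} &
  [/\ h 0 = f 0, h 1 = g 0 & forall t, exists s, h t = f s \/ h t = g s].
Proof.
move=> cf cg fg.
pose h (t : R) := if t <= 2^-1 then f (2 * t) else g (2 - 2 * t).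
exists h; last first.
  rewrite /h invr_ge0 ler0n mulr0; split => //.
    rewrite ifF; first by congr g; ring.
    by apply/negbTE; rewrite -ltNge invf_lt1// ltr1n.
  by move=> t; case: ifP => _; [exists (2 * t); left|exists (2 - 2 * t); right].
have -> : `[0, 1]%classic = `[0, 2^-1] `|` `[2^-1, 1] :> set R.
  apply/seteqP; split => t /=; rewrite !in_itv /=; last by case; lra.
  by move=> /andP[t0 t1]; have [?|/ltW ?] := lerP t 2^-1; [left|right]; apply/andP.
apply: withinU_continuous; [exact: interval_closed|exact: interval_closed| |].
- apply: (@subspace_eq_continuous R `[0, 2^-1]%classic T
    (from_subspace `[0, 2^-1]%classic (fun t : R => f (2 * t))) (from_subspace `[0, 2^-1]%classic h)).
    move=> t; rewrite inE /= in_itv /= => /andP[_ t1]; by rewrite /from_subspace /h t1.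
  apply: continuous_subspaceT => t; apply: continuous_comp; last exact: cf.
  by apply: cvgM; [exact: cvg_cst|exact: cvg_id].
- apply: (@subspace_eq_continuous R `[2^-1, 1]%classic T
    (from_subspace `[2^-1, 1]%classic (fun t : R => g (2 - 2 * t))) (from_subspace `[2^-1, 1]%classic h)).
    move=> t; rewrite inE /= in_itv /= => /andP[t1 _]; rewrite /from_subspace /h.
    case: ifP => // t2; have -> : t = 2^-1 by apply/eqP; rewrite eq_le t2.
    by rewrite divff// (_ : 2 - 1 = 1) ?fg//; ring.
  apply: continuous_subspaceT => t; apply: continuous_comp; last exact: cg.
  apply: cvgB; first exact: cvg_cst.
  by apply: cvgM; [exact: cvg_cst|exact: cvg_id].
Qed.

Lemma base_point : exists2 A : @punctured R 5, val A = std_curve 1 0 0 & limit_curve (val A).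
Proof.
have ad : admissible (1 : R) 0 0 by left.
have nz : std_curve (1 : R) 0 0 \in @punctured R 5.
  rewrite inE /punctured /=; apply/eqP => /matrixP/(_ (inord 0) (inord 0)).
  by rewrite mxE inordK//= -/(coord _ 0) /std_a coord_vec4 mxE => /eqP; rewrite oner_eq0.
exists (exist (fun A => A \in @punctured R 5) _ nz : @punctured R 5) => //=.
split; last by move=> z; exact: std_curve_hor.
by move=> i j k l; rewrite sigma_real_curve.
Qed.

End Path.

Theorem theorem6p10 (R : realType) : path_connected R (AHHol_LF_le R 5).
Proof.
split.
  by have [A _ hA] := @base_point R; exists (proj_point A); exact: limit_closure.
move=> x y /closure_limit_curve[A hA ->] /closure_limit_curve[B hB ->].
have [f [cf f0 _ fl [P Pv f1]]] := limit_path hA.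
have [g [cg g0 _ gl [Q Qv g1]]] := limit_path hB.
have fg : f 1 = g 1.
  by rewrite f1 g1; congr proj_point; apply: val_inj; rewrite Pv Qv.
have [h ch [h0 h1 hl]] := join_paths cf cg fg.
exists h => //; split; [by rewrite h0|by rewrite h1|].
move=> t _; have [s [->|->]] := hl t.
  by have [D hD ->] := fl s; exact: limit_closure.
by have [D hD ->] := gl s; exact: limit_closure.
Qed.
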